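(* Let $S$ and $T$ be ultramatricial algebras over a semifield $F$. Then there exists a monoid isomorphism $f \colon \mathcal{V}(S) \to \mathcal{V}(T)$ such that $f(\overline{S}) = \overline{T}$ if and only if $S \cong T$ as $F$-algebras.
   Context: A semiring $(S,+,\cdot,0,1)$ consists of a commutative monoid $(S,+,0)$ and a monoid $(S,\cdot,1)$ such that multiplication distributes over addition on both sides and $0s=0=s0$. A semifield is a commutative semiring $F$ with $(F\setminus\{0\},\cdot,1)$ a group. A (unital) $F$-algebra is an $F$-semimodule with an associative $F$-bilinear multiplication with identity element. A matricial $F$-algebra is an $F$-algebra isomorphic to $M_{n_1}(F)\times\cdots\times M_{n_r}(F)$ for some positive integers $n_1,\dots,n_r$. An $F$-algebra is ultramatricial if it is isomorphic to the direct limit, in the category of unital $F$-algebras, of a sequence $S_1\to S_2\to\cdots$ of matricial $F$-algebras. Right $S$-semimodules are commutative monoids with a unital, biadditive, associative right action of $S$ with $0_Ms=0_M=m0$. A finitely generated projective right $S$-semimodule is a retract of $S^n$ for some $n$ (i.e. a semimodule $P$ with homomorphisms $f\colon S^n\to P$, $g\colon P\to S^n$ such that $f\circ g=\mathrm{id}_P$). $\mathcal{V}(S)$ is the commutative monoid of isomorphism classes $\overline{P}$ of finitely generated projective right $S$-semimodules, with $\overline{P}+\overline{Q}=\overline{P\oplus Q}$ and zero element $\overline{0}$. *)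

(* Defs.v *)
From HB Require Import structures.
From mathcomp Require Import all_boot all_order all_algebra.
From mathcomp Require Import boolp.

Set Implicit Arguments.
Unset Strict Implicit.
Unset Printing Implicit Defensive.

Import GRing.Theory.
Local Open Scope ring_scope.

(* The nonzero elements form a group under multiplication; [1 != 0] and
   commutativity come from [comNzSemiRingType]. *)
Definition is_semifield (F : comNzSemiRingType) : Prop :=
  (forall x y : F, x != 0 -> y != 0 -> x * y != 0) /\
  (forall x : F, x != 0 -> exists2 y : F, y != 0 & x * y = 1).

(* A [semiAlgType F] is a unital F-algebra with [1 != 0].  The zero algebra is
   not a [semiAlgType F]; it is never matricial (see [matprod]) nor a direct
   limit of matricial algebras, since unital morphisms preserve [1 != 0]. *)
Definition alg_iso (F : comNzSemiRingType) (A B : semiAlgType F) : Prop :=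
  exists f : {lrmorphism A -> B}, bijective f.

(* matprod F m [:: m2; ...; mr] is M_(m+1)(F) * M_(m2+1)(F) * ... * M_(mr+1)(F);
   the shifts make every size positive, and there is at least one factor. *)
Fixpoint matprod (F : comNzSemiRingType) (m : nat) (ms : seq nat) :
    semiAlgType F :=
  if ms is m' :: ms' then ('M[F]_m.+1 * matprod F m' ms')%type
  else 'M[F]_m.+1.

Definition matricial (F : comNzSemiRingType) (A : semiAlgType F) : Prop :=
  exists (m : nat) (ms : seq nat), alg_iso A (matprod F m ms).

(* Universal property of the colimit of A 0 -> A 1 -> ... in the category of
   unital F-algebras.  Testing it on nonzero B only is no restriction: a cocone
   on nonzero algebras to the zero algebra factors uniquely through any L. *)
Definition is_direct_limit (F : comNzSemiRingType) (A : nat -> semiAlgType F)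
    (f : forall n, {lrmorphism A n -> A n.+1}) (L : semiAlgType F)
    (phi : forall n, {lrmorphism A n -> L}) : Prop :=
  (forall n x, phi n.+1 (f n x) = phi n x) /\
  (forall (B : semiAlgType F) (psi : forall n, {lrmorphism A n -> B}),
     (forall n x, psi n.+1 (f n x) = psi n x) ->
     exists h : {lrmorphism L -> B},
       (forall n x, h (phi n x) = psi n x) /\
       (forall h' : {lrmorphism L -> B},
          (forall n x, h' (phi n x) = psi n x) -> h' =1 h)).

Definition ultramatricial (F : comNzSemiRingType) (S : semiAlgType F) : Prop :=
  exists (A : nat -> semiAlgType F) (f : forall n, {lrmorphism A n -> A n.+1})
         (phi : forall n, {lrmorphism A n -> S}),
    (forall n, matricial (A n)) /\ is_direct_limit f phi.

(* A right S-semimodule is a left semimodule over the converse semiring S^c,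
   with m s written [s *: m]. *)
Notation rSemiModType S := (lSemiModType S^c).

Definition mod_iso (S : pzSemiRingType) (P Q : rSemiModType S) : Prop :=
  exists f : {linear P -> Q}, bijective f.

Definition fg_projective (S : pzSemiRingType) (P : rSemiModType S) : Prop :=
  exists (n : nat) (f : {linear 'rV[S^c]_n -> P}) (g : {linear P -> 'rV[S^c]_n}),
    cancel g f.

Record fgproj (S : pzSemiRingType) := FGProj {
  fgproj_mod :> rSemiModType S;
  fgprojP : fg_projective fgproj_mod }.

Section Iso.
Variable S : pzSemiRingType.
Implicit Types P Q R : rSemiModType S.

Lemma mod_iso_refl P : mod_iso P P.
Proof. by exists idfun; exists idfun. Qed.

Lemma mod_iso_sym P Q : mod_iso P Q -> mod_iso Q P.
Proof.
move=> [f [g fK gK]].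
have gs : semilinear g.
  split=> [a x|x y]; apply: (can_inj fK); last by rewrite gK linearD !gK.
  by rewrite gK linearZ gK.
exists (HB.pack_for {linear Q -> P} g (GRing.isSemilinear.Build _ _ _ _ g gs)).
by exists f.
Qed.

Lemma mod_iso_trans P Q R : mod_iso P Q -> mod_iso Q R -> mod_iso P R.
Proof. by move=> [f fb] [g gb]; exists (g \o f); apply: bij_comp. Qed.

Lemma mod_iso_sum P P' Q Q' :
  mod_iso P P' -> mod_iso Q Q' -> mod_iso (P * Q)%type (P' * Q')%type.
Proof.
move=> [f [f' fK f'K]] [g [g' gK g'K]].
pose h (u : P * Q) := (f u.1, g u.2).
have hs : semilinear h.
  by split=> [a u|u v]; rewrite /h /= ?linearZ ?raddfD.
exists (HB.pack_for {linear (P * Q)%type -> (P' * Q')%type} h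
  (GRing.isSemilinear.Build _ _ _ _ h hs)).
exists (fun u => (f' u.1, g' u.2)) => -[x y] /=; first by rewrite fK gK.
by rewrite /h /= f'K g'K.
Qed.

Lemma mod_iso_sumA P Q R :
  mod_iso (P * (Q * R))%type (P * Q * R)%type.
Proof.
pose h (u : P * (Q * R)) := ((u.1, u.2.1), u.2.2).
have hs : semilinear h by [].
exists (HB.pack_for {linear (P * (Q * R))%type -> (P * Q * R)%type} h
  (GRing.isSemilinear.Build _ _ _ _ h hs)).
by exists (fun u => (u.1.1, (u.1.2, u.2))) => [[x []]|[[]]].
Qed.

Lemma mod_iso_sumC P Q : mod_iso (P * Q)%type (Q * P)%type.
Proof.
pose h (u : P * Q) := (u.2, u.1).
have hs : semilinear h by [].
exists (HB.pack_for {linear (P * Q)%type -> (Q * P)%type} h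
  (GRing.isSemilinear.Build _ _ _ _ h hs)).
by exists (fun u => (u.2, u.1)) => -[].
Qed.

Lemma mod_iso_sum0 P : mod_iso ('rV[S^c]_0 * P)%type P.
Proof.
pose h (u : 'rV[S^c]_0 * P) := u.2.
have hs : semilinear h by [].
exists (HB.pack_for {linear ('rV[S^c]_0 * P)%type -> P} h
  (GRing.isSemilinear.Build _ _ _ _ h hs)).
by exists (fun x => (0, x)) => [[z x]|//]; congr pair; apply/matrixP=> i [].
Qed.

Lemma fg_projective_free n : fg_projective 'rV[S^c]_n.
Proof. by exists n, idfun, idfun. Qed.

Lemma fg_projective_iso P Q : mod_iso P Q -> fg_projective P -> fg_projective Q.
Proof.
move=> PQ [n [f [g gK]]]; have [h' _] := mod_iso_sym PQ.
have [h [k hK kK]] := PQ.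
have [k' k'E] : exists k' : {linear Q -> P}, k' =1 k.
  have ks : semilinear k.
    split=> [a x|x y]; apply: (can_inj hK); last by rewrite kK linearD !kK.
    by rewrite kK linearZ kK.
  by exists (HB.pack_for {linear Q -> P} k
    (GRing.isSemilinear.Build _ _ _ _ k ks)).
exists n, (h \o f), (g \o k') => x /=.
by rewrite gK k'E kK.
Qed.

Lemma fg_projective_reg : fg_projective ((S^c)^o : rSemiModType S).
Proof.
apply: (fg_projective_iso _ (fg_projective_free 1)).
pose h (v : 'rV[S^c]_1) : (S^c)^o := v 0 0.
have hs : semilinear h by split=> [a u|u v]; rewrite /h mxE.
exists (HB.pack_for {linear 'rV[S^c]_1 -> (S^c)^o} h
  (GRing.isSemilinear.Build _ _ _ _ h hs)).
exists (fun x => \row_(_ < 1) (x : S^c)) => [v|x]; last by rewrite /h /= mxE.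
by apply/rowP=> i; rewrite ord1 mxE.
Qed.

Lemma fg_projective_sum P Q :
  fg_projective P -> fg_projective Q -> fg_projective (P * Q)%type.
Proof.
move=> [m [f [g gK]]] [n [f' [g' g'K]]].
pose h (u : 'rV[S^c]_(m + n)) := (f (lsubmx u), f' (rsubmx u)).
pose k (u : P * Q) := row_mx (g u.1) (g' u.2).
have hs : semilinear h.
  split=> [a u|u v]; rewrite /h.
    have -> : lsubmx (a *: u) = a *: lsubmx u by apply/matrixP=> i j; rewrite !mxE.
    have -> : rsubmx (a *: u) = a *: rsubmx u by apply/matrixP=> i j; rewrite !mxE.
    by rewrite !linearZ.
  have -> : lsubmx (u + v) = lsubmx u + lsubmx v by apply/matrixP=> i j; rewrite !mxE.
  have -> : rsubmx (u + v) = rsubmx u + rsubmx v by apply/matrixP=> i j; rewrite !mxE.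
  by rewrite !raddfD.
have ks : semilinear k.
  split=> [a u|u v]; rewrite /k /= ?linearZ ?raddfD; apply/matrixP=> i j;
    by rewrite !mxE; case: split_ordP => l _; rewrite !mxE.
exists (m + n)%N, (HB.pack_for {linear 'rV[S^c]_(m + n) -> (P * Q)%type} h
  (GRing.isSemilinear.Build _ _ _ _ h hs)),
  (HB.pack_for {linear (P * Q)%type -> 'rV[S^c]_(m + n)} k
  (GRing.isSemilinear.Build _ _ _ _ k ks)).
by move=> [x y]; rewrite /= /h /k /= row_mxKl row_mxKr gK g'K.
Qed.

End Iso.

Definition fgproj_zero (S : pzSemiRingType) : fgproj S :=
  FGProj (fg_projective_free S 0).

Definition fgproj_regular (S : pzSemiRingType) : fgproj S :=
  FGProj (fg_projective_reg S).

Definition fgproj_sum (S : pzSemiRingType) (P Q : fgproj S) : fgproj S :=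
  FGProj (fg_projective_sum (fgprojP P) (fgprojP Q)).

(* The monoid V(S): its elements are the isomorphism classes, as predicates on
   [fgproj S].  This type is too large for the universe of the carriers of
   [nmodType]s, hence the bare operations below. *)
Record vmonoid (S : pzSemiRingType) := VMonoid {
  vcarrier : fgproj S -> Prop;
  vcarrierP : exists P : fgproj S, vcarrier = (fun Q => mod_iso P Q) }.

Section VMonoid.
Variable S : pzSemiRingType.
Implicit Types (P Q R : fgproj S) (x y z : vmonoid S).

Definition vclass P : vmonoid S :=
  VMonoid (ex_intro _ P (erefl (fun Q => mod_iso P Q))).

Lemma vmonoid_inj x y : vcarrier x = vcarrier y -> x = y.
Proof.
case: x y => [C hC] [D hD] /= eCD; case: _ / eCD hD => hD.
by congr VMonoid; apply: Prop_irrelevance.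
Qed.

Lemma vclassP P Q : vclass P = vclass Q <-> mod_iso P Q.
Proof.
split=> [/(congr1 (fun x => vcarrier x Q)) /= -> |PQ].
  exact: mod_iso_refl.
apply: vmonoid_inj; apply/funext => R /=; apply/propext; split => h.
  exact: mod_iso_trans (mod_iso_sym PQ) h.
exact: mod_iso_trans PQ h.
Qed.

Lemma vclass_surj x : exists P, x = vclass P.
Proof. by case: (vcarrierP x) => P eP; exists P; apply: vmonoid_inj. Qed.

Lemma vmonoid_ind (K : vmonoid S -> Prop) :
  (forall P, K (vclass P)) -> forall x, K x.
Proof. by move=> h x; have [P ->] := vclass_surj x. Qed.

Definition vadd_carrier x y : fgproj S -> Prop := fun R =>
  exists P Q, [/\ vcarrier x P, vcarrier y Q & mod_iso (P * Q)%type R].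

Fact vadd_subproof x y :
  exists P, vadd_carrier x y = (fun Q => mod_iso P Q).
Proof.
have [P ->] := vclass_surj x; have [Q ->] := vclass_surj y.
exists (fgproj_sum P Q); apply/funext => R; apply/propext; split.
  case=> P' [Q' [/= PP' QQ' h]].
  exact: mod_iso_trans (mod_iso_sum PP' QQ') h.
by move=> h; exists P, Q; split=> //=; apply: mod_iso_refl.
Qed.

Definition vzero : vmonoid S := vclass (fgproj_zero S).
Definition vadd x y : vmonoid S := VMonoid (vadd_subproof x y).

Lemma vaddE P Q : vadd (vclass P) (vclass Q) = vclass (fgproj_sum P Q).
Proof.
apply: vmonoid_inj; apply/funext => R; apply/propext; split.
  case=> P' [Q' [/= PP' QQ' h]].
  exact: mod_iso_trans (mod_iso_sum PP' QQ') h.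
by move=> h; exists P, Q; split=> //=; apply: mod_iso_refl.
Qed.

Lemma vaddA : associative vadd.
Proof.
elim/vmonoid_ind=> P; elim/vmonoid_ind=> Q; elim/vmonoid_ind=> R.
by rewrite !vaddE; apply/vclassP/mod_iso_sumA.
Qed.

Lemma vaddC : commutative vadd.
Proof.
elim/vmonoid_ind=> P; elim/vmonoid_ind=> Q.
by rewrite !vaddE; apply/vclassP/mod_iso_sumC.
Qed.

Lemma vadd0 : left_id vzero vadd.
Proof.
by elim/vmonoid_ind=> P; rewrite vaddE; apply/vclassP/mod_iso_sum0.
Qed.

HB.instance Definition _ :=
  Monoid.isComLaw.Build (vmonoid S) vzero vadd vaddA vaddC vadd0.

End VMonoid.

Definition vmonoid_iso (S T : pzSemiRingType) (f : vmonoid S -> vmonoid T) :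
    Prop :=
  [/\ f (vzero S) = vzero T, {morph f : x y / vadd x y} & bijective f].

(* Main.v *)
Require Import Defs.
From HB Require Import structures.
From mathcomp Require Import all_boot all_order all_algebra.
From mathcomp Require Import boolp.

(* Elliott's intertwining argument, carried out with idempotents.  The class of
   a module P that is a retract of S_S is recorded by an idempotent e of S with
   P = eS; two such modules are isomorphic exactly when their idempotents are
   Murray-von Neumann equivalent, and splittings of eS correspond to splittings
   of e into orthogonal idempotents.  Hence, if f : V(S) -> V(T) maps [S] to
   [T], applying f to the decomposition of [S] given by the matrix units of
   A_n in S = lim A_n yields matrix units in T, that is, a morphism A_n -> T,
   which factors through some B_m when T = lim B_m.

   Over a semifield F, every idempotent p of M_n(F) with p + p' = 1 is
   equivalent to a sum of diagonal matrix units: F is either a field, where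
   one uses a rank factorization, or free of nonzero additive inverses, where
   the off-diagonal entries of p vanish.  Therefore the morphisms so obtained
   induce f on all complemented idempotents of A_n, and not only on the
   minimal ones.  Two morphisms between matricial algebras that agree up to
   equivalence on the minimal idempotents are conjugate, so alternating f and
   its inverse, and correcting by inner automorphisms, makes the ladder
   A_n1 -> B_m1 -> A_n2 -> B_m2 -> ... commute exactly. *)

Set Implicit Arguments.
Unset Strict Implicit.
Unset Printing Implicit Defensive.

Import GRing.Theory.
Local Open Scope ring_scope.

(** * Idempotents and retracts of the regular module *)

Lemma semilinear_fun (R : pzSemiRingType) (U V : lSemiModType R) (g : U -> V) :
  semilinear g -> exists h : {linear U -> V}, h =1 g.
Proof.
move=> gs.
by exists (HB.pack_for {linear U -> V} g (GRing.isSemilinear.Build _ _ _ _ g gs)).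
Qed.

(** Murray-von Neumann equivalence. No compatibility such as [e * u = u] is built in; between
    idempotents it can be arranged afterwards, see [mvn_normalize]. *)
Definition mvn_equiv (S : pzSemiRingType) (e e' : S) : Prop :=
  exists u v : S, u * v = e /\ v * u = e'.

(** A right linear endomorphism of the regular module is left multiplication by its value at 1.
    Hence [i \o p] is multiplication by [e], and [i] identifies P with eS. *)
Definition retract_by (S : pzSemiRingType) (P : rSemiModType S) (e : S) : Prop :=
  exists (i : {linear P -> (S^c)^o}) (p : {linear (S^c)^o -> P}),
    cancel i p /\ i (p (1 : S)) = e.

Section Retract.
Variable S : pzSemiRingType.
Implicit Types (P Q : rSemiModType S) (e : S).

Lemma linear_regE P (p : {linear (S^c)^o -> P}) (x : S) :
  p x = (x : S^c) *: p (1 : S).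
Proof. by rewrite -linearZ /=; congr (p _); exact: esym (mul1r x). Qed.

Lemma linear_reg_mull (p : {linear (S^c)^o -> (S^c)^o}) (x : S) :
  p x = (p (1 : S) : S) * x.
Proof. by rewrite linear_regE. Qed.

Lemma lmul_linear (v : S) :
  exists g : {linear (S^c)^o -> (S^c)^o}, forall x : S, g x = v * x.
Proof.
pose g (x : (S^c)^o) : (S^c)^o := v * (x : S).
have gs : semilinear g.
  by split=> [a x|x y]; rewrite /g; [exact: (@mulrA S)|exact: (@mulrDr S)].
by have [h hE] := semilinear_fun gs; exists h.
Qed.

Lemma retract_ip P (e : S) (i : {linear P -> (S^c)^o}) (p : {linear (S^c)^o -> P}) :
  i (p (1 : S)) = e -> forall x : S, i (p x) = e * x.
Proof. by move=> ip1 x; have /= -> := linear_reg_mull (i \o p) x; rewrite ip1. Qed.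

Lemma retract_idem P e : retract_by P e -> e * e = e.
Proof. by move=> [i [p [ipK ip1]]]; rewrite -(retract_ip ip1) -ip1 ipK. Qed.

Lemma mod_iso_inv P Q : mod_iso P Q ->
  exists (f : {linear P -> Q}) (g : {linear Q -> P}), cancel f g /\ cancel g f.
Proof.
move=> [f [g fK gK]].
have gs : semilinear g.
  split=> [a x|x y]; apply: (can_inj fK); last by rewrite gK linearD !gK.
  by rewrite gK linearZ gK.
by have [h hE] := semilinear_fun gs; exists f, h; split=> x; rewrite hE.
Qed.

(** Homomorphisms between eS and e'S are left multiplications: an isomorphism and its inverse yield
    [v] and [u] as their values on generators, and conversely multiplication by [v] and by [u] gives
    mutually inverse maps. *)
Lemma retract_mod_iso P Q e e' : retract_by P e -> retract_by Q e' ->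
  (mod_iso P Q <-> mvn_equiv e e').
Proof.
move=> [i [p [ipK ip1]]] [j [q [jqK jq1]]]; split=> [/mod_iso_inv [h [k [hK kK]]]|].
  exists (i (k (q (1 : S)))), (j (h (p (1 : S)))); split.
    have /= <- := linear_reg_mull (i \o (k \o q)) (j (h (p (1 : S)))).
    by rewrite jqK hK.
  have /= <- := linear_reg_mull (j \o (h \o p)) (i (k (q (1 : S)))).
  by rewrite ipK kK.
have ee : e * e = e by apply: (@retract_idem P); exists i, p.
have e'e' : e' * e' = e' by apply: (@retract_idem Q); exists j, q.
move=> [u [v [uv vu]]].
have [gu guE] := lmul_linear u; have [gv gvE] := lmul_linear v.
exists (q \o (gv \o i)), (p \o (gu \o j)) => x /=.
  rewrite guE gvE (retract_ip jq1) -vu !mulrA uv -[e * u * v]mulrA uv ee.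
  by rewrite -(retract_ip ip1) !ipK.
rewrite guE gvE (retract_ip ip1) -uv !mulrA vu -[e' * v * u]mulrA vu e'e'.
by rewrite -(retract_ip jq1) !jqK.
Qed.

Lemma retract_reg : retract_by ((S^c)^o : rSemiModType S) 1.
Proof. by exists idfun, idfun. Qed.

Lemma retract0 : retract_by ('rV[S^c]_0 : rSemiModType S) 0.
Proof.
pose i (x : 'rV[S^c]_0) : (S^c)^o := 0.
pose p (x : (S^c)^o) : 'rV[S^c]_0 := 0.
have is_ : semilinear i by split=> [a x|x y]; rewrite /i ?scaler0 ?addr0.
have ps : semilinear p by split=> [a x|x y]; rewrite /p ?scaler0 ?addr0.
have [i' iE] := semilinear_fun is_; have [p' pE] := semilinear_fun ps.
exists i', p'; split=> [x|]; last by rewrite iE.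
by apply/matrixP=> k [].
Qed.

(** Orthogonality kills the cross maps [p \o j] and [q \o i], so [i] and [j] add up to a split
    embedding of the direct sum. *)
Lemma retract_sum P Q e e' : retract_by P e -> retract_by Q e' ->
  e * e' = 0 -> e' * e = 0 -> retract_by (P * Q)%type (e + e').
Proof.
move=> rP rQ ee' e'e; have := (rP, rQ).
move=> [[i [p [ipK ip1]]] [j [q [jqK jq1]]]].
pose f (x : P * Q) : (S^c)^o := i x.1 + j x.2.
pose g (x : (S^c)^o) : P * Q := (p x, q x).
have fs : semilinear f.
  by split=> [a x|x y]; rewrite /f /= ?linearZ ?raddfD /= ?scalerDr // addrACA.
have gs : semilinear g by split=> [a x|x y]; rewrite /g ?linearZ ?raddfD.
have [f' fE] := semilinear_fun fs; have [g' gE] := semilinear_fun gs.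
exists f', g'; split=> [[x y]|]; last by rewrite fE gE /f /= ip1 jq1.
have pj : p (j y) = 0.
  rewrite -(jqK y) (retract_ip jq1) -(ipK (p _)) (retract_ip ip1) mulrA ee'.
  by rewrite mul0r raddf0.
have qi : q (i x) = 0.
  rewrite -(ipK x) (retract_ip ip1) -(jqK (q _)) (retract_ip jq1) mulrA e'e.
  by rewrite mul0r raddf0.
by rewrite fE gE /f /g /= !raddfD /= ipK jqK pj qi addr0 add0r.
Qed.

Lemma retract_split P Q e : retract_by (P * Q)%type e ->
  exists e1 e2, [/\ retract_by P e1, retract_by Q e2, e1 * e2 = 0, e2 * e1 = 0
                  & e = e1 + e2].
Proof.
move=> [i [p [ipK ip1]]].
pose in1 (x : P) : P * Q := (x, 0); pose in2 (x : Q) : P * Q := (0, x).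
pose p1 (x : P * Q) := x.1; pose p2 (x : P * Q) := x.2.
have in1s : semilinear in1 by split=> [a x|x y]; congr pair; rewrite ?scaler0 ?addr0.
have in2s : semilinear in2 by split=> [a x|x y]; congr pair; rewrite ?scaler0 ?addr0.
have p1s : semilinear p1 by split. have p2s : semilinear p2 by split.
have [j1 j1E] := semilinear_fun in1s; have [j2 j2E] := semilinear_fun in2s.
have [q1 q1E] := semilinear_fun p1s; have [q2 q2E] := semilinear_fun p2s.
(* These are the two coordinate projections of the sum, transported to S. Since [i] is split by [p],
   they inherit idempotency and orthogonality. *)
pose e1 : S := i (j1 (q1 (p (1 : S)))); pose e2 : S := i (j2 (q2 (p (1 : S)))).
exists e1, e2; split.
- exists (i \o j1), (q1 \o p); split=> // x /=.
  by rewrite ipK q1E j1E.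
- exists (i \o j2), (q2 \o p); split=> // x /=.
  by rewrite ipK q2E j2E.
- rewrite -[e1 * e2](linear_reg_mull (i \o (j1 \o (q1 \o p)))) /= /e2 ipK q1E j2E.
  by rewrite !raddf0.
- rewrite -[e2 * e1](linear_reg_mull (i \o (j2 \o (q2 \o p)))) /= /e1 ipK q2E j1E.
  by rewrite !raddf0.
rewrite -ip1 /e1 /e2 -raddfD /=; congr (i _).
rewrite j1E j2E q1E q2E /in1 /in2 /p1 /p2.
case: (p _) => x y; by congr pair; rewrite /= ?addr0 ?add0r.
Qed.

End Retract.

(** * The right module eS *)

Section Corner.
Variables (S : pzSemiRingType) (e : S).

(** For idempotent [e] the fixed points of left multiplication by [e] are exactly eS; this form is a
    boolean predicate, from which a subtype can be built. *)
Definition corner_pred : {pred (S^c)^o} := fun x : S => e * x == x.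

Fact corner_subsemimod_closed : GRing.subsemimod_closed corner_pred.
Proof.
split=> [|a x].
  split=> [|x y]; rewrite !unfold_in; first by rewrite mulr0.
  by move=> /eqP ex /eqP ey; rewrite mulrDr ex ey.
by rewrite !unfold_in => /eqP ex; rewrite (@mulrA S) ex.
Qed.
HB.instance Definition _ := GRing.isSubSemiModClosed.Build _ _ corner_pred
  corner_subsemimod_closed.

Record corner := Corner { corner_val : (S^c)^o; _ : corner_val \in corner_pred }.
HB.instance Definition _ := [isSub for corner_val].
HB.instance Definition _ := [Choice of corner by <:].
HB.instance Definition _ := [SubChoice_isSubLSemiModule of corner by <:].
End Corner.

Lemma retract_corner (S : pzSemiRingType) (e : S) : e * e = e ->
  retract_by (corner e : rSemiModType S) e.
Proof.
move=> ee.
pose p (x : (S^c)^o) : corner e := Corner (introT eqP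
  (etrans (mulrA e e (x : S)) (congr1 ( *%R^~ (x : S)) ee)) : _ \in corner_pred e).
have ps : semilinear p.
  by split=> [a x|x y]; apply: val_inj; [exact: (@mulrA S)|exact: (@mulrDr S)].
have is_ : semilinear (val : corner e -> (S^c)^o) by [].
have [p' pE] := semilinear_fun ps; have [i' iE] := semilinear_fun is_.
exists i', p'; split=> [x|].
  by apply: val_inj; rewrite iE pE /=; apply/eqP; apply: (valP x).
by rewrite iE pE /= mulr1.
Qed.

Lemma retract_fg_projective (S : pzSemiRingType) (P : rSemiModType S) e :
  retract_by P e -> fg_projective P.
Proof.
move=> [i [p [ipK _]]]; have [n [f [g gK]]] := fg_projective_reg S.
by exists n, (p \o f), (g \o i) => x /=; rewrite gK ipK.
Qed.

(** * Classes in V(S) represented by idempotents of S *)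

(** Reads x = [eS]. It is a relation, because [e] is determined by [x] only up to equivalence and
    exists only for classes of retracts of the regular module. *)
Definition vrep (S : pzSemiRingType) (x : vmonoid S) (e : S) : Prop :=
  exists P : fgproj S, x = vclass P /\ retract_by P e.

Section VRep.
Variable S : pzSemiRingType.
Implicit Types (x y : vmonoid S) (e : S).

Lemma vrep_ex e : e * e = e -> exists x, vrep x e.
Proof.
move=> /retract_corner eP.
by exists (vclass (FGProj (retract_fg_projective eP))); eexists; split.
Qed.

Lemma vrep_idem x e : vrep x e -> e * e = e.
Proof. by move=> [P [_ /retract_idem]]. Qed.

Lemma vrep_mvn x y e e' : vrep x e -> vrep y e' -> (x = y <-> mvn_equiv e e').
Proof.
move=> [P [-> rP]] [Q [-> rQ]].
have [h h'] := retract_mod_iso rP rQ; by split=> [/vclassP/h|/h'/vclassP].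
Qed.

Lemma vrep_reg : vrep (vclass (fgproj_regular S)) 1.
Proof. by exists (fgproj_regular S); split=> //; exact: retract_reg. Qed.

Lemma vrep0 : vrep (vzero S) 0.
Proof. by exists (fgproj_zero S); split=> //; exact: retract0. Qed.

Lemma vrepD x y e e' : vrep x e -> vrep y e' -> e * e' = 0 -> e' * e = 0 ->
  vrep (vadd x y) (e + e').
Proof.
move=> [P [-> rP]] [Q [-> rQ]] ee' e'e; exists (fgproj_sum P Q).
by rewrite vaddE; split=> //; apply: retract_sum.
Qed.

Lemma vrep_split x y e : vrep (vadd x y) e ->
  exists e1 e2, [/\ vrep x e1, vrep y e2, e1 * e2 = 0, e2 * e1 = 0 & e = e1 + e2].
Proof.
elim/vmonoid_ind: x => P; elim/vmonoid_ind: y => Q; rewrite vaddE => -[R [/vclassP]].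
move=> /mod_iso_inv [f [g [fK gK]]] [i [p [ipK ip1]]].
have /retract_split [e1 [e2 [r1 r2 e12 e21 ->]]] :
    retract_by (fgproj_mod P * fgproj_mod Q)%type e.
  by exists (i \o f), (g \o p); split=> [x|] /=; rewrite ?ipK ?fK ?gK.
by exists e1, e2; split=> //; [exists P|exists Q].
Qed.

(** Replace [u] by [e * u] and [v] by [e' * v]; the key identity is e u = u v u = u e'. *)
Lemma mvn_normalize e e' : e * e = e -> e' * e' = e' -> mvn_equiv e e' ->
  exists u v, [/\ u * v = e, v * u = e', e * u = u, u * e' = u
                & e' * v = v /\ v * e = v].
Proof.
move=> ee e'e' [u [v [uv vu]]].
have A : e * u = u * e' by rewrite -uv -vu mulrA.
have B : e' * v = v * e by rewrite -uv -vu mulrA.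
exists (e * u), (e' * v); split; last split.
- by rewrite A -mulrA (mulrA e') e'e' B mulrA uv ee.
- by rewrite B -mulrA (mulrA e) ee A mulrA vu e'e'.
- by rewrite mulrA ee.
- by rewrite A -mulrA e'e'.
- by rewrite mulrA e'e'.
- by rewrite B -mulrA ee.
Qed.

Lemma mvn_refl e : e * e = e -> mvn_equiv e e.
Proof. by exists e, e. Qed.

Lemma mvn_sym e e' : mvn_equiv e e' -> mvn_equiv e' e.
Proof. by move=> [u [v []]]; exists v, u. Qed.

Lemma vrep_equiv x e e' : e' * e' = e' -> mvn_equiv e e' -> vrep x e -> vrep x e'.
Proof.
move=> /vrep_ex [y ye'] ee' xe.
by have -> : x = y by apply/(vrep_mvn xe ye').
Qed.

Local Notation "\vsum_ ( i <- r ) E" := (\big[@vadd S/vzero S]_(i <- r) E)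
  (at level 41, E at level 41, i, r at level 50).

Lemma vrep_sum (I : eqType) (r : seq I) (x : I -> vmonoid S) (e : I -> S) :
  uniq r -> (forall i, i \in r -> vrep (x i) (e i)) ->
  (forall i j, i \in r -> j \in r -> i != j -> e i * e j = 0) ->
  vrep (\vsum_(i <- r) x i) (\sum_(i <- r) e i).
Proof.
elim: r => [|i r IH] /= => [_ _ _|/andP [ir ur] xe eo].
  by rewrite !big_nil; exact: vrep0.
have ine j : j \in r -> i != j by move=> jr; apply: contraNneq ir => ->.
have mi : i \in i :: r by rewrite inE eqxx.
have mr j : j \in r -> j \in i :: r by rewrite inE => ->; rewrite orbT.
rewrite !big_cons; apply: vrepD; first exact: xe.
- by apply: IH => // [j /mr /xe//|j k /mr jr /mr kr]; apply: eo.
- rewrite mulr_sumr big_seq big1 // => j jr; apply: eo => //; [exact: mr|exact: ine].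
- rewrite mulr_suml big_seq big1 // => j jr; apply: eo => //; [exact: mr|].
  by rewrite eq_sym ine.
Qed.

(** Summands are split off one at a time. The pieces of the tail lie below [e2], hence are
    orthogonal to [e1]. *)
Lemma vrep_sum_split (I : eqType) (r : seq I) (x : I -> vmonoid S) (e : S) :
  uniq r -> vrep (\vsum_(i <- r) x i) e ->
  exists t : I -> S, [/\ forall i, i \in r -> vrep (x i) (t i),
    forall i j, i \in r -> j \in r -> i != j -> t i * t j = 0 &
    \sum_(i <- r) t i = e].
Proof.
elim: r e => [|i r IH] /= e => [_|/andP [ir ur]].
  rewrite big_nil => he; exists (fun=> 0); split=> //.
  (* Only 0 represents the zero class: from u v = e and v u = 0 it follows that e = e e = u (v u) v
     = 0. *)
  have /(vrep_mvn he) [/(_ erefl) [u [v [uv vu]]] _] := vrep0.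
  by rewrite big_nil -(vrep_idem he) -uv mulrA -(mulrA u) vu mulr0 mul0r.
rewrite big_cons => /vrep_split [e1 [e2 [xe1 xe2 e12 e21 ->]]].
have [t [xt to ts]] := IH _ ur xe2.
have ine j : j \in r -> (j == i) = false.
  by move=> jr; apply: contraNF ir => /eqP <-.
have tt j : j \in r -> t j * t j = t j by move=> /xt /vrep_idem.
have te2 j : j \in r -> t j * e2 = t j /\ e2 * t j = t j.
  move=> jr; rewrite -ts mulr_sumr mulr_suml; split.
    rewrite (bigD1_seq j) //= tt // big_seq_cond big1 ?addr0 // => k /andP [kr kj].
    by apply: to => //; rewrite eq_sym.
  rewrite (bigD1_seq j) //= tt // big_seq_cond big1 ?addr0 // => k /andP [kr kj].
  by apply: to.
exists (fun j => if j == i then e1 else t j); split.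
- by move=> j; rewrite inE; case: eqP => [->|_ /= /xt].
- move=> j k; rewrite !inE.
  case: (eqVneq j i) => [->|ji]; case: (eqVneq k i) => [->|ki] //=.
  + by move=> _ /te2 [_ <-] _; rewrite mulrA e12 mul0r.
  + by move=> /te2 [<- _] _ _; rewrite -mulrA e21 mulr0.
  by move=> jr kr; apply: to.
rewrite big_cons eqxx -ts; congr (_ + _); rewrite big_seq [RHS]big_seq.
by apply: eq_bigr => j jr; rewrite ine.
Qed.

End VRep.

(** * Restriction of scalars *)

(** A synonym of the carrier that remembers [h], so that the T-action through [h] can be declared
    next to the original S-action. *)
Definition restriction (S T : pzSemiRingType) (h : {rmorphism T -> S})
  (M : rSemiModType S) : Type := M.

Section Restriction.
Variables (S T : pzSemiRingType) (h : {rmorphism T -> S}).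
Local Notation restriction := (restriction h).

Section Structure.
Variable M : rSemiModType S.
HB.instance Definition _ := GRing.Nmodule.on (restriction M).

Definition restriction_scale (a : T^c) (m : restriction M) : restriction M :=
  (h a : S^c) *: (m : M).

Fact restriction_scalerA a b m :
  restriction_scale a (restriction_scale b m) = restriction_scale (a * b) m.
Proof. by rewrite /restriction_scale scalerA [in RHS](rmorphM h). Qed.
Fact restriction_scale0r m : restriction_scale 0 m = 0.
Proof. by rewrite /restriction_scale (rmorph0 h) scale0r. Qed.
Fact restriction_scale1r : left_id 1 restriction_scale.
Proof. by move=> m; rewrite /restriction_scale (rmorph1 h) (scale1r (m : M)). Qed.
Fact restriction_scalerDr : right_distributive restriction_scale +%R.
Proof. by move=> a x y; rewrite /restriction_scale scalerDr. Qed.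
Fact restriction_scalerDl m : {morph restriction_scale^~ m : a b / a + b}.
Proof. by move=> a b; rewrite /restriction_scale (rmorphD h) scalerDl. Qed.
HB.instance Definition _ := GRing.Nmodule_isLSemiModule.Build T^c (restriction M)
  restriction_scalerA restriction_scale0r restriction_scale1r
  restriction_scalerDr restriction_scalerDl.
End Structure.

Lemma restriction_linear (M N : rSemiModType S) (f : {linear M -> N}) :
  exists g : {linear restriction M -> restriction N}, forall x : M, g x = f x.
Proof.
have fs : semilinear (f : restriction M -> restriction N).
  split=> [a x|x y]; last exact: (raddfD f).
  exact: (linearZ_LR f (h a : S^c) (x : M)).
by have [g gE] := semilinear_fun fs; exists g.
Qed.

Lemma restriction_mod_iso (M N : rSemiModType S) :
  mod_iso M N -> mod_iso (restriction M) (restriction N).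
Proof.
move=> /mod_iso_inv [f [g [fK gK]]].
have [f' f'E] := restriction_linear f; have [g' g'E] := restriction_linear g.
by exists f', g' => x; rewrite f'E g'E ?fK ?gK.
Qed.

Lemma restriction_sum (M N : rSemiModType S) :
  mod_iso (restriction (M * N)%type) (restriction M * restriction N)%type.
Proof.
have fs : semilinear (idfun : restriction (M * N)%type -> 
    (restriction M * restriction N)%type) by [].
by have [f fE] := semilinear_fun fs; exists f, id => x; rewrite fE.
Qed.

Lemma restriction_rV n : bijective h ->
  mod_iso (restriction 'rV[S^c]_n) 'rV[T^c]_n.
Proof.
move=> [k hK kK].
have kM (x y : S) : k (x * y) = k x * k y.
  by apply: (can_inj hK); rewrite rmorphM !kK.
have kD (x y : S) : k (x + y) = k x + k y.
  by apply: (can_inj hK); rewrite rmorphD !kK.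
pose f (v : restriction 'rV[S^c]_n) : 'rV[T^c]_n :=
  \row_j (k ((v : 'rV[S^c]_n) 0 j) : T^c).
have fs : semilinear f.
  split=> [a x|x y]; apply/rowP=> j; rewrite !mxE //.
  by rewrite [LHS]kM hK.
have [g gE] := semilinear_fun fs.
exists g; exists (fun v : 'rV[T^c]_n => \row_j (h (v 0 j) : S^c)) => v.
  by rewrite gE; apply/rowP=> j; rewrite !mxE kK.
by rewrite gE; apply/rowP=> j; rewrite !mxE hK.
Qed.

Lemma restriction_fg_projective (M : rSemiModType S) : bijective h ->
  fg_projective M -> fg_projective (restriction M).
Proof.
move=> hb [n [f [g gK]]].
have [f' f'E] := restriction_linear f; have [g' g'E] := restriction_linear g.
have [a [b [aK bK]]] := mod_iso_inv (restriction_rV n hb).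
by exists n, (f' \o b), (a \o g') => x /=; rewrite aK f'E g'E gK.
Qed.

Lemma restriction_reg : bijective h ->
  mod_iso (restriction (S^c)^o) ((T^c)^o : rSemiModType T).
Proof.
move=> [k hK kK].
have kM (x y : S) : k (x * y) = k x * k y.
  by apply: (can_inj hK); rewrite rmorphM !kK.
have kD (x y : S) : k (x + y) = k x + k y.
  by apply: (can_inj hK); rewrite rmorphD !kK.
have fs : semilinear (k : restriction (S^c)^o -> (T^c)^o).
  by split=> [a x|x y]; rewrite ?kD // [LHS]kM hK.
by have [g gE] := semilinear_fun fs; exists g, h => x; rewrite gE.
Qed.
End Restriction.

(** A scalar [a] acts on the doubly restricted module through h (k a) = a, so the identity map is
    linear. *)
Lemma restrictionK (S T : pzSemiRingType) (h : {rmorphism T -> S})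
    (k : {rmorphism S -> T}) (M : rSemiModType S) : cancel k h ->
  mod_iso (restriction k (restriction h M)) M.
Proof.
move=> kK.
have fs : semilinear (id : restriction k (restriction h M) -> M).
  split=> // a x; rewrite /GRing.scale /= /restriction_scale.
  by rewrite /GRing.scale /= /restriction_scale kK.
by have [f fE] := semilinear_fun fs; exists f, id => x; rewrite fE.
Qed.

Section VRestriction.
Variables (S T : pzSemiRingType) (h : {rmorphism T -> S}) (hb : bijective h).

Definition fgproj_restriction (P : fgproj S) : fgproj T :=
  FGProj (restriction_fg_projective hb (fgprojP P)).

(** Uses a chosen representative of the class; [vrestrictionE] shows that the choice does not
    matter. *)
Definition vrestriction (x : vmonoid S) : vmonoid T :=
  vclass (fgproj_restriction (projT1 (cid (vclass_surj x)))).

Lemma vrestrictionE P : vrestriction (vclass P) = vclass (fgproj_restriction P).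
Proof.
rewrite /vrestriction; case: cid => Q /= /vclassP PQ.
by apply/vclassP/restriction_mod_iso/mod_iso_sym.
Qed.

Lemma vrestriction0 : vrestriction (vzero S) = vzero T.
Proof. by rewrite vrestrictionE; apply/vclassP/restriction_rV. Qed.

Lemma vrestrictionD : {morph vrestriction : x y / vadd x y}.
Proof.
elim/vmonoid_ind=> P; elim/vmonoid_ind=> Q.
by rewrite vaddE !vrestrictionE vaddE; apply/vclassP/restriction_sum.
Qed.

Lemma vrestriction_reg :
  vrestriction (vclass (fgproj_regular S)) = vclass (fgproj_regular T).
Proof. by rewrite vrestrictionE; apply/vclassP/restriction_reg. Qed.
End VRestriction.

Lemma vrestrictionK (S T : pzSemiRingType) (h : {rmorphism T -> S})
    (k : {rmorphism S -> T}) (hb : bijective h) (kb : bijective k) :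
  cancel k h -> cancel (vrestriction hb) (vrestriction kb).
Proof.
move=> kK; elim/vmonoid_ind=> P; rewrite !vrestrictionE; apply/vclassP.
exact: restrictionK.
Qed.

Lemma rmorphism_inv (S T : pzSemiRingType) (h : {rmorphism S -> T}) : bijective h ->
  exists k : {rmorphism T -> S}, cancel h k /\ cancel k h.
Proof.
move=> [k hK kK].
have kD : nmod_morphism k.
  split=> [|x y]; apply: (can_inj hK); first by rewrite rmorph0 kK.
  by rewrite rmorphD !kK.
have kM : monoid_morphism k.
  split=> [|x y]; apply: (can_inj hK); first by rewrite rmorph1 kK.
  by rewrite rmorphM !kK.
by exists (HB.pack_for {rmorphism T -> S} k (GRing.isNmodMorphism.Build _ _ k kD)
  (GRing.isMonoidMorphism.Build _ _ k kM)).
Qed.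

(** The easy direction of the theorem: restrict scalars along the inverse of [h]. *)
Lemma vmonoid_iso_of_rmorphism (S T : pzSemiRingType) (h : {rmorphism S -> T}) :
  bijective h -> exists f : vmonoid S -> vmonoid T,
    vmonoid_iso f /\ f (vclass (fgproj_regular S)) = vclass (fgproj_regular T).
Proof.
move=> hb; have [k [hK kK]] := rmorphism_inv hb.
have kb : bijective k by exists h.
exists (vrestriction kb); split; last exact: vrestriction_reg.
split; [exact: vrestriction0|exact: vrestrictionD|].
by exists (vrestriction hb); apply: vrestrictionK.
Qed.

(** * Direct limits *)

Lemma lrmorphism_fun (F : pzSemiRingType) (A B : semiAlgType F) (g : A -> B) :
  semilinear g -> monoid_morphism g -> exists h : {lrmorphism A -> B}, h =1 g.
Proof.
move=> gl gm.
by exists (HB.pack_for {lrmorphism A -> B} g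
  (GRing.isSemilinear.Build _ _ _ _ g gl) (GRing.isMonoidMorphism.Build _ _ g gm)).
Qed.

(* Sequences modulo eventual equality form an algebra that receives every chain;
   testing the universal property of a direct limit on it shows that elements
   with equal images in the limit are equal at a finite stage, without
   constructing the limit. *)
Section Germs.
Variables (F : pzSemiRingType) (A : nat -> semiAlgType F).
Local Notation seqs := (forall n, A n).

Definition eventually_eq (x y : seqs) : Prop :=
  exists N, forall n, (N <= n)%N -> x n = y n.

(** The quotient consists of the equivalence classes themselves, as predicates; extensionality turns
    eventual equality into equality. Operations are computed on chosen representatives and then
    shown independent of them. *)
Record germ := Germ {
  germ_class : seqs -> Prop;
  germ_classP : exists x, germ_class = eventually_eq x }.

HB.instance Definition _ := gen_eqMixin germ.
HB.instance Definition _ := gen_choiceMixin germ.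

Definition germ_of (x : seqs) : germ := Germ (ex_intro _ x erefl).

Lemma germ_of_surj q : exists x, q = germ_of x.
Proof.
case: q => C [x eC]; exists x; case: _ / (esym eC) (ex_intro _ _ _) => h.
by congr Germ; apply: Prop_irrelevance.
Qed.

Lemma germ_ind (K : germ -> Prop) : (forall x, K (germ_of x)) -> forall q, K q.
Proof. by move=> h q; have [x ->] := germ_of_surj q. Qed.

Lemma germ_eqP x y : germ_of x = germ_of y <-> eventually_eq x y.
Proof.
split=> [/(congr1 (fun q => germ_class q y)) /= ->|[N xy]]; first by exists 0%N.
have e : eventually_eq x = eventually_eq y.
  apply/funext => z; apply/propext; split=> -[M h]; exists (maxn N M) => n;
    by rewrite geq_max => /andP [/xy e /h <-].
rewrite /germ_of; case: _ / e (ex_intro _ y _) => h.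
by congr Germ; apply: Prop_irrelevance.
Qed.

Definition germ_repr (q : germ) : seqs := projT1 (cid (germ_of_surj q)).

Lemma germ_reprK q : germ_of (germ_repr q) = q.
Proof. by rewrite /germ_repr; case: cid. Qed.

Definition germ_add p q := germ_of (fun n => germ_repr p n + germ_repr q n).
Definition germ_mul p q := germ_of (fun n => germ_repr p n * germ_repr q n).
Definition germ_scale a q := germ_of (fun n => a *: germ_repr q n).

Lemma germ_reprP x : eventually_eq (germ_repr (germ_of x)) x.
Proof. by apply/germ_eqP; rewrite germ_reprK. Qed.

Lemma germ_addE x y : germ_add (germ_of x) (germ_of y) = germ_of (fun n => x n + y n).
Proof.
have [N hN] := germ_reprP x; have [M hM] := germ_reprP y; apply/germ_eqP.
by exists (maxn N M) => n; rewrite geq_max => /andP [/hN -> /hM ->].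
Qed.

Lemma germ_mulE x y : germ_mul (germ_of x) (germ_of y) = germ_of (fun n => x n * y n).
Proof.
have [N hN] := germ_reprP x; have [M hM] := germ_reprP y; apply/germ_eqP.
by exists (maxn N M) => n; rewrite geq_max => /andP [/hN -> /hM ->].
Qed.

Lemma germ_scaleE a x : germ_scale a (germ_of x) = germ_of (fun n => a *: x n).
Proof.
by have [N hN] := germ_reprP x; apply/germ_eqP; exists N => n /hN ->.
Qed.

Let germE := (germ_addE, germ_mulE, germ_scaleE).
Let zero := germ_of (fun=> 0).
Let one := germ_of (fun=> 1).

Lemma eq_germ (x y : seqs) : (forall n, x n = y n) -> germ_of x = germ_of y.
Proof. by move=> xy; apply/germ_eqP; exists 0%N => n _. Qed.

Fact germ_addA : associative germ_add.
Proof.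
elim/germ_ind=> x; elim/germ_ind=> y; elim/germ_ind=> z.
by rewrite !germE; apply: eq_germ => n; rewrite addrA.
Qed.
Fact germ_addC : commutative germ_add.
Proof.
elim/germ_ind=> x; elim/germ_ind=> y.
by rewrite !germE; apply: eq_germ => n; rewrite addrC.
Qed.
Fact germ_add0 : left_id zero germ_add.
Proof. by elim/germ_ind=> x; rewrite !germE; apply: eq_germ => n; rewrite add0r. Qed.
HB.instance Definition _ := GRing.isNmodule.Build germ germ_addA germ_addC germ_add0.

Fact germ_mulA : associative germ_mul.
Proof.
elim/germ_ind=> x; elim/germ_ind=> y; elim/germ_ind=> z.
by rewrite !germE; apply: eq_germ => n; rewrite mulrA.
Qed.
Fact germ_mul1r : left_id one germ_mul.
Proof. by elim/germ_ind=> x; rewrite !germE; apply: eq_germ => n; rewrite mul1r. Qed.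
Fact germ_mulr1 : right_id one germ_mul.
Proof. by elim/germ_ind=> x; rewrite !germE; apply: eq_germ => n; rewrite mulr1. Qed.
Fact germ_mulDl : left_distributive germ_mul germ_add.
Proof.
elim/germ_ind=> x; elim/germ_ind=> y; elim/germ_ind=> z.
by rewrite !germE; apply: eq_germ => n; rewrite mulrDl.
Qed.
Fact germ_mulDr : right_distributive germ_mul germ_add.
Proof.
elim/germ_ind=> x; elim/germ_ind=> y; elim/germ_ind=> z.
by rewrite !germE; apply: eq_germ => n; rewrite mulrDr.
Qed.
Fact germ_mul0r : left_zero zero germ_mul.
Proof. by elim/germ_ind=> x; rewrite !germE; apply: eq_germ => n; rewrite mul0r. Qed.
Fact germ_mulr0 : right_zero zero germ_mul.
Proof. by elim/germ_ind=> x; rewrite !germE; apply: eq_germ => n; rewrite mulr0. Qed.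
Fact germ_oner_neq0 : one != zero.
Proof.
apply/eqP => /germ_eqP [N /(_ N (leqnn N))] /eqP.
by rewrite (negPf (oner_neq0 _)).
Qed.
HB.instance Definition _ := GRing.Nmodule_isNzSemiRing.Build germ germ_mulA
  germ_mul1r germ_mulr1 germ_mulDl germ_mulDr germ_mul0r germ_mulr0 germ_oner_neq0.

Fact germ_scalerA a b q : germ_scale a (germ_scale b q) = germ_scale (a * b) q.
Proof.
by elim/germ_ind: q => x; rewrite !germE; apply: eq_germ => n; rewrite scalerA.
Qed.
Fact germ_scale0r q : germ_scale 0 q = 0.
Proof.
elim/germ_ind: q => x; rewrite germ_scaleE.
by apply: (@eq_germ _ (fun=> 0)) => n; rewrite scale0r.
Qed.
Fact germ_scale1r : left_id 1 germ_scale.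
Proof.
by elim/germ_ind=> x; rewrite !germE; apply: eq_germ => n; rewrite scale1r.
Qed.
Fact germ_scalerDr : right_distributive germ_scale germ_add.
Proof.
move=> a; elim/germ_ind=> x; elim/germ_ind=> y.
by rewrite !germE; apply: eq_germ => n; rewrite scalerDr.
Qed.
Fact germ_scalerDl q : {morph germ_scale^~ q : a b / a + b >-> germ_add a b}.
Proof.
move=> a b; elim/germ_ind: q => x.
by rewrite !germE; apply: eq_germ => n; rewrite scalerDl.
Qed.
HB.instance Definition _ := GRing.Nmodule_isLSemiModule.Build F germ
  germ_scalerA germ_scale0r germ_scale1r germ_scalerDr germ_scalerDl.

Fact germ_scalerAl a p q : germ_scale a (germ_mul p q) = germ_mul (germ_scale a p) q.
Proof.
elim/germ_ind: p => x; elim/germ_ind: q => y.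
by rewrite !germE; apply: eq_germ => n; rewrite scalerAl.
Qed.
HB.instance Definition _ := GRing.LSemiModule_isLSemiAlgebra.Build F germ germ_scalerAl.
Fact germ_scalerAr a p q : germ_scale a (germ_mul p q) = germ_mul p (germ_scale a q).
Proof.
elim/germ_ind: p => x; elim/germ_ind: q => y.
by rewrite !germE; apply: eq_germ => n; rewrite scalerAr.
Qed.
HB.instance Definition _ := GRing.LSemiAlgebra_isSemiAlgebra.Build F germ germ_scalerAr.
End Germs.

(** * Transition maps of a chain *)

Section Transition.
Variables (F : pzSemiRingType) (A : nat -> semiAlgType F).
Variable f : forall n, {lrmorphism A n -> A n.+1}.

Definition transport n m (e : n = m) : A n -> A m :=
  match e in _ = k return A n -> A k with erefl => id end.

(* The value is [0] when [m < n]. *)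
Fixpoint transition n m (x : A n) : A m :=
  match @eqP _ n m with
  | ReflectT e => transport e x
  | ReflectF _ => match m return A m with 0 => 0 | m'.+1 => f m' (transition m' x) end
  end.

Lemma transition_id n (x : A n) : transition n x = x.
Proof. by case: n x => [|n] x /=; case: eqP => // e; rewrite (eq_axiomK e). Qed.

Lemma transition_step n m (x : A n) : (n <= m)%N ->
  transition m.+1 x = f m (transition m x).
Proof. by move=> nm /=; case: eqP => // e; rewrite e ltnn in nm. Qed.

Lemma transition_ind n (K : nat -> Prop) :
  K n -> (forall m, (n <= m)%N -> K m -> K m.+1) -> forall m, (n <= m)%N -> K m.
Proof.
move=> K0 KS; elim=> [|m IH]; first by rewrite leqn0 => /eqP <-.
by rewrite leq_eqVlt => /predU1P [<- //|nm]; apply: KS => //; apply: IH.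
Qed.

Lemma transition_lrmorphism n m : (n <= m)%N ->
  exists t : {lrmorphism A n -> A m}, t =1 @transition n m.
Proof.
move: m; apply: transition_ind.
  by exists idfun => x; rewrite transition_id.
by move=> m nm [t tE]; exists (f m \o t) => x; rewrite transition_step // -tE.
Qed.

Lemma transition_comp n m p (x : A n) : (n <= m)%N -> (m <= p)%N ->
  transition p (transition m x) = transition p x.
Proof.
move=> nm; move: p; apply: transition_ind; first by rewrite transition_id.
by move=> p mp IH; rewrite !transition_step // ?IH // (leq_trans nm).
Qed.

Lemma transition_cocone (B : semiAlgType F) (psi : forall n, {lrmorphism A n -> B}) :
  (forall n x, psi n.+1 (f n x) = psi n x) ->
  forall n m (x : A n), (n <= m)%N -> psi m (transition m x) = psi n x.
Proof.
move=> psif n m x; move: m; apply: transition_ind; first by rewrite transition_id.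
by move=> m nm IH; rewrite transition_step // psif.
Qed.
End Transition.

(** * Subalgebras and the union of the images of a chain *)

Section Subalgebra.
Variables (F : pzSemiRingType) (B : semiAlgType F) (P : subalgClosed B).

Record subalg := Subalg { subalg_val : B; _ : subalg_val \in P }.
HB.instance Definition _ := [isSub for subalg_val].
HB.instance Definition _ := [Choice of subalg by <:].
HB.instance Definition _ := [SubChoice_isSubSemiAlgebra of subalg by <:].

Lemma lrmorphism_subalg (A : semiAlgType F) (psi : {lrmorphism A -> B}) :
  (forall x, psi x \in P) ->
  exists h : {lrmorphism A -> subalg}, forall x, subalg_val (h x) = psi x.
Proof.
move=> psiP; pose g x := Subalg (psiP x).
have gl : semilinear g.
  by split=> [a x|x y]; apply: val_inj; rewrite /= ?linearZ ?raddfD.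
have gm : monoid_morphism g.
  by split=> [|x y]; apply: val_inj; rewrite /= ?rmorph1 ?rmorphM.
by have [h hE] := lrmorphism_fun gl gm; exists h => x; rewrite hE.
Qed.

Lemma subalg_val_lrmorphism : exists v : {lrmorphism subalg -> B}, v =1 subalg_val.
Proof. by apply: lrmorphism_fun; split. Qed.
End Subalgebra.

Section Image.
Variables (F : pzSemiRingType) (A : nat -> semiAlgType F).
Variable f : forall n, {lrmorphism A n -> A n.+1}.
Variables (B : semiAlgType F) (psi : forall n, {lrmorphism A n -> B}).
Hypothesis psif : forall n x, psi n.+1 (f n x) = psi n x.

Definition image_pred : {pred B} := fun x => `[< exists n y, psi n y = x >].

Lemma image_predP x : reflect (exists n y, psi n y = x) (x \in image_pred).
Proof. exact: asboolP. Qed.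

(** The images of a cocone increase along the chain, so two elements come from one stage; this makes
    their union a subalgebra. *)
Lemma image_common x y : x \in image_pred -> y \in image_pred ->
  exists n a b, x = psi n a /\ y = psi n b.
Proof.
move=> /image_predP [n [a <-]] /image_predP [m [b <-]].
exists (maxn n m), (transition f (maxn n m) a), (transition f (maxn n m) b).
by rewrite !(transition_cocone psif) ?leq_maxl ?leq_maxr.
Qed.

Fact image_subsemialg_closed : GRing.subsemialg_closed image_pred.
Proof.
split.
- by apply/image_predP; exists 0%N, 1; rewrite rmorph1.
- split=> [|x y ix iy]; first by apply/image_predP; exists 0%N, 0; rewrite rmorph0.
  have [n [a [b [-> ->]]]] := image_common ix iy.
  by apply/image_predP; exists n, (a + b); rewrite rmorphD.
- move=> a x /image_predP [n [y <-]]; apply/image_predP.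
  by exists n, (a *: y); rewrite linearZ.
move=> x y ix iy; have [n [a [b [-> ->]]]] := image_common ix iy.
by apply/image_predP; exists n, (a * b); rewrite rmorphM.
Qed.
End Image.

Lemma dep_choice (I : Type) (U : I -> Type) (R : forall i, U i -> Prop) :
  (forall i, exists u, R i u) -> exists u : forall i, U i, forall i, R i (u i).
Proof. by move=> h; exists (fun i => projT1 (cid (h i))) => i; apply: projT2. Qed.

Section Limit.
Variables (F : comNzSemiRingType) (A : nat -> semiAlgType F).
Variable f : forall n, {lrmorphism A n -> A n.+1}.
Variables (L : semiAlgType F) (phi : forall n, {lrmorphism A n -> L}).
Hypothesis limL : is_direct_limit f phi.

(** The union of the images is a subalgebra receiving the chain, so L maps to it. Followed by the
    inclusion this map is the identity, by uniqueness, and hence every element of L lies in the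
    union. *)
Lemma direct_limit_surj x : exists n a, phi n a = x.
Proof.
have [phif univ] := limL.
pose P : subalgClosed L := HB.pack (image_pred phi)
  (GRing.isSubSemiAlgClosed.Build _ _ _ (image_subsemialg_closed phif)).
have phiP n y : phi n y \in P by apply/image_predP; exists n, y.
have [psi psiE] := dep_choice (fun n => lrmorphism_subalg (phiP n)).
have psif n y : psi n.+1 (f n y) = psi n y.
  by apply: val_inj; rewrite /= !psiE phif.
have [h [hE _]] := univ _ psi psif.
have [g [_ gU]] := univ _ phi phif.
have idg := gU idfun (fun _ _ => erefl).
have [v vE] := subalg_val_lrmorphism P.
have hg : v \o h =1 g by apply: gU => n y /=; rewrite hE vE psiE.
by have /image_predP := valP (h x); rewrite -[val _]vE [v _]hg -idg.
Qed.

Lemma direct_limit_inj n (x y : A n) : phi n x = phi n y ->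
  exists m, (n <= m)%N /\ transition f m x = transition f m y.
Proof.
move=> xy; have [phif univ] := limL.
pose g n (x : A n) : germ A := germ_of (fun m => transition f m x).
(* The default values of [transition] before stage [k] do not affect the germ, so identities need
   checking only where the transition maps are morphisms. *)
have eq_late k (u v : forall m, A m) : (forall m, (k <= m)%N -> u m = v m) ->
    germ_of u = germ_of v.
  by move=> uv; apply/germ_eqP; exists k.
have gl k : semilinear (g k).
  split=> [a u|u v].
    rewrite [RHS](germ_scaleE a); apply: (eq_late k) => m km.
    by have [t tE] := transition_lrmorphism f km; rewrite -!tE linearZ.
  rewrite [RHS]germ_addE; apply: (eq_late k) => m km.
  by have [t tE] := transition_lrmorphism f km; rewrite -!tE raddfD.
have gm k : monoid_morphism (g k).
  split=> [|u v].
    apply: (eq_late k) => m km.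
    by have [t tE] := transition_lrmorphism f km; rewrite -tE rmorph1.
  rewrite [RHS]germ_mulE; apply: (eq_late k) => m km.
  by have [t tE] := transition_lrmorphism f km; rewrite -!tE rmorphM.
have [psi psiE] := dep_choice (fun k => lrmorphism_fun (gl k) (gm k)).
have psif k u : psi k.+1 (f k u) = psi k u.
  rewrite !psiE; apply: (eq_late k.+1) => m km.
  by rewrite -[u in f k u](transition_id f) -transition_step // transition_comp.
have [h [hE _]] := univ _ psi psif.
have /germ_eqP [N hN] : g n x = g n y by rewrite -!psiE -!hE xy.
by exists (maxn n N); split; [rewrite leq_maxl|apply: hN; rewrite leq_maxr].
Qed.
End Limit.

(** * Idempotent matrices over a semifield *)

Lemma sum_delta_mx_diag (R : pzSemiRingType) n (D : {set 'I_n}) :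
  \sum_(i in D) delta_mx i i = \matrix_(i, j) ((i == j) && (i \in D))%:R :> 'M[R]_n.
Proof.
apply/matrixP => i j; rewrite summxE mxE.
under eq_bigr => k _ do rewrite mxE.
have [iD|iD] := boolP (i \in D).
  rewrite (bigD1 i) //= eqxx andbT eq_sym big1 ?addr0 // => k /andP [_ ki].
  by rewrite eq_sym (negPf ki).
rewrite andbF big1 // => k kD; have [ik|//] := eqVneq i k.
by rewrite ik kD in iD.
Qed.

(** Take a rank factorization p = C R. As C has a left and R a right inverse, cancelling them in p p
    = p leaves R C = 1. *)
Lemma idem_mx_field (K : fieldType) n (p : 'M[K]_n) : p *m p = p ->
  exists (D : {set 'I_n}) (u v : 'M[K]_n),
    u *m v = p /\ v *m u = \sum_(i in D) delta_mx i i.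
Proof.
have [r [C [R [a [b [rn <- aC Rb]]]]]] : exists r (C : 'M_(n, r)) (R : 'M_(r, n)) a b,
    [/\ (r <= n)%N, C *m R = p, a *m C = 1%:M & R *m b = 1%:M].
  have [b bE] := row_freeP (row_base_free p).
  have [a aE] := row_fullP (col_base_full p).
  exists (\rank p), (col_base p), (row_base p), a, b.
  by split=> //; [exact: rank_leq_row|exact: mulmx_base].
move=> pp; have RC : R *m C = 1%:M.
  have := congr1 (fun x => a *m x *m b) pp.
  by rewrite /= !mulmxA aC mul1mx -!mulmxA Rb !mulmx1.
(* The rectangular partial identities pad C and R to square matrices without changing the product C
   R. *)
exists [set i : 'I_n | (i < r)%N], (C *m pid_mx r), (pid_mx r *m R).
split; first by rewrite -mulmxA (mulmxA (pid_mx r)) pid_mx_id // pid_mx_1 mul1mx.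
rewrite -mulmxA (mulmxA R) RC mul1mx pid_mx_id // sum_delta_mx_diag.
by apply/matrixP => i j; rewrite !mxE inE.
Qed.

Section Semifield.
Variables (F : comNzSemiRingType) (hF : is_semifield F).

(** Here [m] acts as -1, so F is a field under its own operations; the field structure is built on
    the same carrier, so the field case applies verbatim. *)
Lemma idem_mx_neg (m : F) (hm : 1 + m = 0) n (p : 'M[F]_n) : p *m p = p ->
  exists (D : {set 'I_n}) (u v : 'M[F]_n),
    u *m v = p /\ v *m u = \sum_(i in D) delta_mx i i.
Proof.
have [_ inv] := hF.
(* A field structure asks for a total inverse, with value 0 at 0. *)
have invE (x : F) : exists y, if x == 0 then y = 0 else y * x = 1.
  by case: eqVneq => [|/inv [y _ xy]]; [exists 0|exists y; rewrite mulrC].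
have [iv ivE] := choice invE.
have addN : left_inverse 0 ( *%R m) (@GRing.add F).
  by move=> x; rewrite -[X in _ + X]mul1r -mulrDl addrC hm mul0r.
pose Z : comNzRingType := HB.pack (GRing.ComNzSemiRing.sort F) 
  (GRing.ComNzSemiRing.class F) (GRing.Nmodule_isZmodule.Build F addN).
have mulVx : forall x : Z, x != 0 -> iv x * x = 1.
  by move=> x x0; have := ivE x; rewrite (negPf x0).
have inv0 : iv 0 = 0 :> Z by have := ivE 0; rewrite eqxx.
pose K : fieldType := HB.pack (GRing.ComNzSemiRing.sort F) (GRing.ComNzRing.class Z)
  (GRing.ComNzRing_isField.Build Z mulVx inv0).
exact: (@idem_mx_field K n p).
Qed.

(** If 1 has no negative, sums vanish only trivially: p + p' = 1 then forces p to be diagonal, and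
    its diagonal entries, being idempotent in a semifield, are 0 or 1. *)
Lemma complemented_mx n (p p' : 'M[F]_n) :
  p *m p = p -> p + p' = 1%:M -> 
  exists (D : {set 'I_n}) (u v : 'M[F]_n),
    u *m v = p /\ v *m u = \sum_(i in D) delta_mx i i.
Proof.
move=> pp pp'; have [[m hm]|nm] := pselect (exists m : F, 1 + m = 0).
  exact: idem_mx_neg hm _ _ pp.
have [F0 inv] := hF.
have zsf (a b : F) : a + b = 0 -> a = 0.
  (* If [a] had an inverse [c], then 1 + c b = c (a + b) = 0 would make c b a negative of 1. *)
  move=> ab; apply/eqP/negPn/negP => /inv [c _ ac]; apply: nm; exists (c * b).
  by rewrite -ac [a * c]mulrC -mulrDr ab mulr0.
have pij i j : i != j -> p i j = 0.
  by move=> ij; move/matrixP: pp' => /(_ i j); rewrite !mxE (negPf ij) => /zsf.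
have pii i : p i i * p i i = p i i.
  move/matrixP: pp => /(_ i i); rewrite !mxE (bigD1 i) //= big1 ?addr0 // => k ki.
  by rewrite pij 1?eq_sym // mul0r.
exists [set i | p i i != 0], p, p; split=> //; rewrite pp sum_delta_mx_diag.
apply/matrixP => i j; rewrite !mxE inE; have [<-|/pij//] := eqVneq i j.
have [//|/inv [c _ ac]] /= := eqVneq (p i i) 0.
by rewrite -[p i i]mulr1 -ac mulrA pii.
Qed.
End Semifield.

(** * Matrix units and coordinates in matricial algebras *)

Lemma sum_pairl (U V : nmodType) (I : finType) (P : pred I) (f : I -> U) :
  \sum_(i | P i) (f i, 0 : V) = (\sum_(i | P i) f i, 0).
Proof.
elim/big_rec2: _ => [//|i y1 y2 _ ->].
by congr pair; rewrite /= addr0.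
Qed.

Lemma sum_pairr (U V : nmodType) (I : finType) (P : pred I) (f : I -> V) :
  \sum_(i | P i) (0 : U, f i) = (0, \sum_(i | P i) f i).
Proof.
elim/big_rec2: _ => [//|i y1 y2 _ ->].
by congr pair; rewrite /= addr0.
Qed.

(* [J] indexes the diagonal matrix units of all blocks together, and [r] maps an
   index to a chosen representative of its block, so that [e x y] is a matrix
   unit when [r x = r y] and is irrelevant otherwise. *)
Definition unit_system (A : pzSemiRingType) (J : finType) (r : J -> J)
    (e : J -> J -> A) : Prop :=
  [/\ forall x y z, r x = r y -> r y = r z -> e x y * e y z = e x z,
      forall x y z w, y != z -> e x y * e z w = 0 &
      \sum_x e x x = 1].

(** Substitute for the existence of 1 - p; it is preserved by every unital morphism. *)
Definition complemented (A : pzSemiRingType) (p : A) : Prop :=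
  p * p = p /\ exists p', p + p' = 1.

(** All that the argument uses of a matricial algebra: matrix units, coordinates with the matrix
    product rule, and the reduction of complemented idempotents to diagonal ones. Blocks are seen
    only through [r], so finite products need no separate treatment later. *)
Record matrix_basis (F : comNzSemiRingType) (A : semiAlgType F) (J : finType)
    (r : J -> J) (e : J -> J -> A) (c : J -> J -> A -> F) : Prop := MatrixBasis {
  mb_repr : forall x, r (r x) = r x;
  mb_units : unit_system r e;
  mb_coordD : forall x y a b, c x y (a + b) = c x y a + c x y b;
  mb_coordZ : forall x y k a, c x y (k *: a) = k * c x y a;
  mb_coordM : forall x y a b, r x = r y ->
    c x y (a * b) = \sum_(z | r z == r x) c x z a * c z y b;
  mb_coord1 : forall x y, r x = r y -> c x y 1 = (x == y)%:R;
  mb_coord_unit : forall x y z w, r x = r y -> r z = r w ->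
    c x y (e z w) = ((x == z) && (y == w))%:R;
  mb_expand : forall a, \sum_x \sum_(y | r y == r x) c x y a *: e x y = a;
  mb_complemented : forall p, complemented p ->
    exists D : {set J}, mvn_equiv p (\sum_(x in D) e x x) }.

Section MatrixBasis.
Variables (F : comNzSemiRingType) (hF : is_semifield F).

Lemma matrix_basis_mx m : matrix_basis (fun=> ord0 : 'I_m.+1)
  (fun i j => delta_mx i j : 'M[F]_m.+1) (fun i j a => a i j).
Proof.
split=> //.
- split=> [x y z _ _|x y z w yz|].
  + by rewrite -mulmxE mul_delta_mx.
  + by rewrite -mulmxE mul_delta_mx_0.
  rewrite -idmxE (_ : 1%:M = \sum_(i in setT) delta_mx i i).
    by apply: eq_bigl => i; rewrite in_setT.
  by apply/matrixP => i j; rewrite sum_delta_mx_diag !mxE in_setT andbT.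
- by move=> x y a b; rewrite mxE.
- by move=> x y k a; rewrite mxE.
- by move=> x y a b _; rewrite -mulmxE mxE; apply: eq_bigl => z; rewrite eqxx.
- by move=> x y _; rewrite -idmxE mxE.
- by move=> x y z w _ _; rewrite mxE.
- move=> a; rewrite [RHS]matrix_sum_delta; apply: eq_bigr => i _.
  by apply: eq_bigl => j; rewrite eqxx.
move=> p [pp [p' pp']].
have [D [u [v [uv vu]]]] := complemented_mx hF pp pp'.
by exists D, u, v.
Qed.

Definition basis_sum_unit (A B : semiAlgType F) (I J : finType) (d : I -> I -> A)
    (e : J -> J -> B) (x y : I + J) : (A * B)%type :=
  match x, y with
  | inl i, inl i' => (d i i', 0)
  | inr j, inr j' => (0, e j j')
  | _, _ => 0
  end.

Definition basis_sum_coord (A B : semiAlgType F) (I J : finType) (c : I -> I -> A -> F)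
    (c' : J -> J -> B -> F) (x y : I + J) (a : A * B) : F :=
  match x, y with
  | inl i, inl i' => c i i' a.1
  | inr j, inr j' => c' j j' a.2
  | _, _ => 0
  end.

Definition basis_sum_repr (I J : finType) (r : I -> I) (s : J -> J) (x : I + J) :
    I + J :=
  match x with inl i => inl (r i) | inr j => inr (s j) end.

Lemma matrix_basis_prod (A B : semiAlgType F) (I J : finType) (r : I -> I) (s : J -> J)
    (d : I -> I -> A) (e : J -> J -> B) (c : I -> I -> A -> F) (c' : J -> J -> B -> F) :
  matrix_basis r d c -> matrix_basis s e c' ->
  matrix_basis (A := (A * B)%type) (basis_sum_repr r s) (basis_sum_unit d e)
    (basis_sum_coord c c').
Proof.
move=> [rr [d1 d2 d3] cD cZ cM c1 cU cE cC] [ss [e1 e2 e3] kD kZ kM k1 kU kE kC].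
have rE x y : (inl (r x) == inl (r y) :> I + J) = (r x == r y) by [].
have sE x y : (inr (s x) == inr (s y) :> I + J) = (s x == s y) by [].
split.
- by case=> x /=; rewrite ?rr ?ss.
- split.
  + move=> [x|x] [y|y] [z|z] //= [h] [h']; congr pair; rewrite ?mul0r ?d1 ?e1 //.
  + move=> [x|x] [y|y] [z|z] [w|w] //= h; rewrite ?mul0r ?mulr0 //; congr pair => /=;
    rewrite ?mul0r ?mulr0 ?d2 ?e2 //.
  rewrite big_sumType /= sum_pairl sum_pairr d3 e3.
  by congr pair; rewrite /= ?addr0 ?add0r.
- by move=> [x|x] [y|y] a b //=; rewrite ?addr0.
- by move=> [x|x] [y|y] k a //=; rewrite ?mulr0.
- move=> [x|x] [y|y] a b //= [h]; rewrite big_sumType /=.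
  + by rewrite cM // [X in _ + X]big_pred0 ?addr0.
  by rewrite kM // [X in X + _]big_pred0 ?add0r.
- by move=> [x|x] [y|y] //= [h]; rewrite ?c1 ?k1.
- move=> [x|x] [y|y] [z|z] [w|w] //= [h] [h']; rewrite ?cU ?kU //=.
  (* A unit of the other factor has component 0 here, and homogeneity makes every coordinate of 0
     vanish. *)
  + by rewrite -(scale0r 0) cZ mul0r.
  + by rewrite -(scale0r 0) kZ mul0r.
- move=> [a1 a2]; rewrite big_sumType /=.
  under eq_bigr => x _ do rewrite big_sumType /= [X in _ + X]big_pred0 // addr0.
  under [X in _ + X]eq_bigr => x _ do
    rewrite big_sumType /= [X in X + _]big_pred0 // add0r.
  have -> : \sum_x \sum_(y | r y == r x) c x y a1 *: ((d x y, 0) : A * B) = (a1, 0).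
    rewrite -[in RHS](cE a1) -sum_pairl; apply: eq_bigr => x _.
    by rewrite -sum_pairl; apply: eq_bigr => y _; congr pair; rewrite scaler0.
  have -> : \sum_x \sum_(y | s y == s x) c' x y a2 *: ((0, e x y) : A * B) = (0, a2).
    rewrite -[in RHS](kE a2) -sum_pairr; apply: eq_bigr => x _.
    by rewrite -sum_pairr; apply: eq_bigr => y _; congr pair; rewrite scaler0.
  by congr pair; rewrite /= ?addr0 ?add0r.
move=> [p1 p2] [pp [[q1 q2] pq]].
have [D [u [v [uv vu]]]] : exists D : {set I}, mvn_equiv p1 (\sum_(x in D) d x x).
  by apply: cC; split; [exact: (congr1 fst pp)|exists q1; exact: (congr1 fst pq)].
have [D' [u' [v' [uv' vu']]]] : exists D : {set J}, mvn_equiv p2 (\sum_(x in D) e x x).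
  by apply: kC; split; [exact: (congr1 snd pp)|exists q2; exact: (congr1 snd pq)].
exists [set x | match x with inl i => i \in D | inr j => j \in D' end].
exists (u, u'), (v, v').
split; first by congr pair.
rewrite big_sumType /= (eq_bigl (fun i => i \in D)) => [|i]; last by rewrite inE.
rewrite [X in _ + X](eq_bigl (fun j => j \in D')) => [|j]; last by rewrite inE.
by rewrite sum_pairl sum_pairr; congr pair; rewrite /= ?addr0 ?add0r.
Qed.
End MatrixBasis.

Lemma complemented_rmorph (A B : pzSemiRingType) (h : {rmorphism A -> B}) p :
  complemented p -> complemented (h p).
Proof.
move=> [pp [q pq]]; split; first by rewrite -rmorphM pp.
by exists (h q); rewrite -rmorphD pq rmorph1.
Qed.

Lemma mvn_rmorph (A B : pzSemiRingType) (h : {rmorphism A -> B}) p q :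
  mvn_equiv p q -> mvn_equiv (h p) (h q).
Proof. by move=> [u [v [<- <-]]]; exists (h u), (h v); rewrite !rmorphM. Qed.

Lemma unit_system_rmorph (A B : pzSemiRingType) (h : {rmorphism A -> B})
    (J : finType) (r : J -> J) (e : J -> J -> A) :
  unit_system r e -> unit_system r (fun x y => h (e x y)).
Proof.
move=> [e1 e2 e3]; split=> [x y z xy yz|x y z w yz|].
- by rewrite -rmorphM e1.
- by rewrite -rmorphM e2 // rmorph0.
by rewrite -rmorph_sum e3 rmorph1.
Qed.

(** * Morphisms out of an algebra with matrix units *)

Section BasisTheory.
Variables (F : comNzSemiRingType).
Implicit Types (A B C : semiAlgType F).

Lemma lrmorphism_inv A B (h : {lrmorphism A -> B}) : bijective h ->
  exists k : {lrmorphism B -> A}, cancel h k /\ cancel k h.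
Proof.
move=> [k hK kK].
have kl : semilinear k.
  split=> [a x|x y]; apply: (can_inj hK); last by rewrite raddfD /= !kK.
  by rewrite kK linearZ /= kK.
have km : monoid_morphism k.
  split=> [|x y]; apply: (can_inj hK); first by rewrite rmorph1 kK.
  by rewrite rmorphM /= !kK.
by have [k' kE] := lrmorphism_fun kl km; exists k'; split=> x; rewrite kE.
Qed.

Lemma matrix_basis_iso A B (h : {lrmorphism A -> B}) (k : {lrmorphism B -> A})
    (J : finType) (r : J -> J) (e : J -> J -> B) (c : J -> J -> B -> F) :
  cancel h k -> cancel k h -> matrix_basis r e c ->
  matrix_basis r (fun x y => k (e x y)) (fun x y a => c x y (h a)).
Proof.
move=> hK kK [rr eU cD cZ cM c1 cU cE cC]; split=> //.
- exact: unit_system_rmorph.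
- by move=> x y a b; rewrite raddfD cD.
- by move=> x y l a; rewrite linearZ cZ.
- by move=> x y a b xy; rewrite rmorphM cM.
- by move=> x y xy; rewrite rmorph1 c1.
- by move=> x y z w xy zw; rewrite kK cU.
- move=> a; rewrite -[RHS]hK -[in RHS](cE (h a)) rmorph_sum; apply: eq_bigr => x _.
  by rewrite rmorph_sum /=; apply: eq_bigr => y _; rewrite linearZ.
move=> p /(complemented_rmorph h) /cC [D pD]; exists D.
by rewrite -(rmorph_sum k) -[p]hK; apply: mvn_rmorph.
Qed.

Lemma matricial_basis (hF : is_semifield F) A : matricial A ->
  exists (J : finType) (r : J -> J) (e : J -> J -> A) (c : J -> J -> A -> F),
    matrix_basis r e c.
Proof.
move=> [m [ms [h /lrmorphism_inv [k [hK kK]]]]].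
suff [J [r [e [c ec]]]] : exists (J : finType) (r : J -> J)
    (e : J -> J -> matprod F m ms) (c : J -> J -> matprod F m ms -> F),
    matrix_basis r e c.
  by exists J, r; do 2 eexists; exact: matrix_basis_iso hK kK ec.
elim: ms m {h k hK kK} => [|m' ms IH] m.
  by do 4 eexists; exact: (matrix_basis_mx hF m).
have [J [r [e [c ec]]]] := IH m'.
by do 4 eexists; exact: (matrix_basis_prod (matrix_basis_mx hF m) ec).
Qed.

Section Basis.
Variables (A : semiAlgType F) (J : finType) (r : J -> J).
Variables (e : J -> J -> A) (c : J -> J -> A -> F).
Hypothesis ec : matrix_basis r e c.

(** The map is defined linearly through coordinates; the product rule for coordinates matches the
    multiplication table of the units [e']. *)
Lemma basis_extension B (e' : J -> J -> B) : unit_system r e' ->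
  exists h : {lrmorphism A -> B}, forall x y, r x = r y -> h (e x y) = e' x y.
Proof.
have [rr _ cD cZ cM c1 cU _ _] := ec; move=> [e1 e2 e3].
pose g a := \sum_x \sum_(y | r y == r x) c x y a *: e' x y.
have gl : semilinear g.
  split=> [k a|a b].
    rewrite /g scaler_sumr; apply: eq_bigr => x _; rewrite scaler_sumr.
    by apply: eq_bigr => y _; rewrite cZ scalerA.
  rewrite /g -big_split; apply: eq_bigr => x _ /=; rewrite -big_split.
  by apply: eq_bigr => y _ /=; rewrite cD scalerDl.
have gm : monoid_morphism g.
  split=> [|a b].
    rewrite /g -e3; apply: eq_bigr => x _.
    rewrite (bigD1 x) //= c1 // eqxx scale1r big1 ?addr0 // => y /andP [/eqP xy yx].
    by rewrite c1 // eq_sym (negPf yx) scale0r.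
  rewrite /g mulr_suml; apply: eq_bigr => x _; rewrite mulr_suml.
  under eq_bigr => y /eqP yx do rewrite cM // scaler_suml.
  rewrite exchange_big /=; apply: eq_bigr => z /eqP zx.
  (* Only the terms of the second factor whose row index is [z] survive the product with
     [e' x z]. *)
  rewrite [RHS]mulr_sumr [RHS](bigD1 z) //= [X in _ + X]big1 ?addr0 => [|w wz].
    rewrite mulr_sumr zx; apply: eq_bigr => y /eqP yx.
    by rewrite -scalerAl -scalerAr scalerA e1 // zx.
  rewrite mulr_sumr big1 // => y _.
  by rewrite -scalerAl -scalerAr e2 ?scaler0 // eq_sym.
have [h hE] := lrmorphism_fun gl gm; exists h => x y xy; rewrite hE /g.
rewrite (bigD1 x) //= (bigD1 y) ?xy //= cU // !eqxx scale1r big1 => [|z]; last first.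
  by move=> /andP [/eqP zx zy]; rewrite cU ?xy // eqxx (negPf zy) scale0r.
rewrite addr0 big1 ?addr0 // => z zx; rewrite big1 // => w /eqP wz.
by rewrite cU // (negPf zx) scale0r.
Qed.

Lemma basis_lrmorphism_eq B (h h' : {lrmorphism A -> B}) :
  (forall x y, r x = r y -> h (e x y) = h' (e x y)) -> h =1 h'.
Proof.
move=> hh' a; rewrite -(mb_expand ec a) !rmorph_sum; apply: eq_bigr => x _.
by rewrite /= !rmorph_sum; apply: eq_bigr => y /eqP yx; rewrite /= !linearZ /= hh'.
Qed.

Lemma conj_lrmorphism B C (w w' : C) (h : {lrmorphism B -> C}) :
  w' * w = 1 -> w * w' = 1 ->
  exists k : {lrmorphism B -> C}, forall b, k b = w * h b * w'.
Proof.
move=> w'w ww'; pose g b := w * h b * w'.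
have gl : semilinear g.
  split=> [a x|x y]; first by rewrite /g linearZ /= -scalerAr -scalerAl.
  by rewrite /g raddfD /= mulrDr mulrDl.
have gm : monoid_morphism g.
  split=> [|x y]; rewrite /g ?rmorph1 ?mulr1 // rmorphM.
  by rewrite -!mulrA (mulrA w') w'w mul1r.
by have [k kE] := lrmorphism_fun gl gm; exists k.
Qed.

(* The intertwiner of two systems of matrix units built from equivalences of
   their diagonal entries; exchanging the roles of [d] and [d'] gives its
   inverse. *)
Definition intertwiner B (d d' : J -> J -> B) (v : J -> B) :=
  \sum_x d' x (r x) * v (r x) * d (r x) x.

(** Terms with different indices contain a vanishing product of units; the term at [x] collapses
    through [r x] to [d' x x], and these sum to 1. *)
Lemma intertwinerM B (d d' : J -> J -> B) (u v : J -> B) :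
  unit_system r d -> unit_system r d' -> 
  (forall x, u x * v x = d x x) -> (forall x, v x * u x = d' x x) ->
  intertwiner d d' v * intertwiner d' d u = 1.
Proof.
have rr := mb_repr ec.
move=> [d1 d2 d3] [d1' d2' d3'] uv vu.
rewrite /intertwiner mulr_suml -d3'; apply: eq_bigr => x _.
rewrite mulr_sumr (bigD1 x) //= [X in _ + X]big1 ?addr0 => [|y yx].
  rewrite -!mulrA (mulrA (d (r x) x)) d1 // -uv.
  rewrite (mulrA (v (r x))) (mulrA (v (r x))) vu -(mulrA (d' (r x) (r x))).
  by rewrite (mulrA (v (r x))) vu !mulrA !d1'.
rewrite -!mulrA (mulrA (d (r x) x)) d2 1?eq_sym //.
by rewrite mul0r !mulr0.
Qed.

Lemma intertwinerE B (d d' : J -> J -> B) (v : J -> B) x y :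
  unit_system r d -> unit_system r d' -> r x = r y ->
  d' x y * intertwiner d d' v = intertwiner d d' v * d x y.
Proof.
have rr := mb_repr ec.
move=> [d1 d2 _] [d1' d2' _] xy; rewrite /intertwiner mulr_sumr mulr_suml.
rewrite (bigD1 y) //= [X in _ + X]big1 ?addr0 => [|z zy]; last first.
  by rewrite -!mulrA (mulrA (d' _ _)) d2' 1?eq_sym // mul0r.
rewrite [RHS](bigD1 x) //= [X in _ = _ + X]big1 ?addr0 => [|z zx]; last first.
  by rewrite -!mulrA d2 // !mulr0.
by rewrite !mulrA d1' // -!mulrA d1 // ?rr // xy.
Qed.

(** The intertwiner carries [h (e x y)] to [h' (e x y)], and a morphism out of A is determined by
    its values on the units. *)
Lemma basis_conj B (h h' : {lrmorphism A -> B}) :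
  (forall x, mvn_equiv (h (e x x)) (h' (e x x))) ->
  exists w w', [/\ w * w' = 1, w' * w = 1 & forall a, h' a = w * h a * w'].
Proof.
move=> hh'; have eU := mb_units ec.
have [u uE] := choice hh'; have [v vE] := choice uE.
have hU := unit_system_rmorph h eU; have hU' := unit_system_rmorph h' eU.
pose w := intertwiner (fun x y => h (e x y)) (fun x y => h' (e x y)) v.
pose w' := intertwiner (fun x y => h' (e x y)) (fun x y => h (e x y)) u.
have ww' : w * w' = 1 by apply: intertwinerM => // x; have [] := vE x.
have w'w : w' * w = 1 by apply: intertwinerM => // x; have [] := vE x.
have [k kE] := conj_lrmorphism h w'w ww'.
exists w, w'; split=> // a; rewrite -kE; apply: basis_lrmorphism_eq => x y xy.
by rewrite kE -(intertwinerE v hU hU' xy) -mulrA ww' mulr1.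
Qed.
End Basis.
End BasisTheory.

(** * Matricial algebras mapping to a direct limit *)

Lemma fin_eventually (I : finType) (P : I -> nat -> Prop) :
  (forall i, exists N, forall m, (N <= m)%N -> P i m) ->
  exists N, forall m, (N <= m)%N -> forall i, P i m.
Proof.
move=> /choice [N NE]; exists (\max_i N i)%N => m Nm i; apply: NE.
exact: leq_trans (leq_bigmax i) Nm.
Qed.

Section Stages.
Variables (F : comNzSemiRingType) (B : nat -> semiAlgType F).
Variable g : forall n, {lrmorphism B n -> B n.+1}.
Variables (T : semiAlgType F) (psi : forall n, {lrmorphism B n -> T}).
Hypothesis limT : is_direct_limit g psi.
Let psig := transition_cocone limT.1.
Local Notation tr := (transition g).

Lemma limit_lift (I : finType) (t : I -> T) :
  exists n (b : I -> B n), forall i, psi n (b i) = t i.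
Proof.
have [n nE] := choice (fun i => direct_limit_surj limT (t i)).
have [b bE] := dep_choice nE.
exists (\max_i n i)%N, (fun i => tr _ (b i)) => i.
by rewrite psig ?bE //; exact: leq_bigmax.
Qed.

Lemma limit_eq n (x y : B n) : psi n x = psi n y ->
  exists N, forall m, (N <= m)%N -> tr m x = tr m y.
Proof.
move=> /(direct_limit_inj limT) [N [nN xy]]; exists N => m Nm.
by rewrite -(transition_comp _ _ nN Nm) xy transition_comp.
Qed.

Lemma transitionM n m (x y : B n) : (n <= m)%N -> tr m (x * y) = tr m x * tr m y.
Proof.
by move=> nm; have [t tE] := transition_lrmorphism g nm; rewrite -!tE rmorphM.
Qed.

Lemma limit_mvn n (p q : B n) : mvn_equiv (psi n p) (psi n q) ->
  exists N, forall m, (N <= m)%N -> mvn_equiv (tr m p) (tr m q).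
Proof.
move=> [u [v [uv vu]]].
(* Indexing by booleans lifts [u] and [v] to one common stage. *)
have [k [b bE]] := limit_lift (fun c : bool => if c then u else v).
pose N := maxn n k; pose b' c := tr N (b c).
have nN : (n <= N)%N by rewrite leq_maxl.
have kN : (k <= N)%N by rewrite leq_maxr.
have b'E c : psi N (b' c) = if c then u else v by rewrite psig ?bE.
have [|M1 h1] := @limit_eq N (b' true * b' false) (tr N p).
  by rewrite rmorphM /= !b'E psig.
have [|M2 h2] := @limit_eq N (b' false * b' true) (tr N q).
  by rewrite rmorphM /= !b'E psig.
exists (maxn N (maxn M1 M2)) => m; rewrite geq_max => /andP [Nm].
rewrite geq_max => /andP [/h1 + /h2].
rewrite !transitionM // !(transition_comp _ _ nN Nm) => e1 e2.
by exists (tr m (b' true)), (tr m (b' false)).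
Qed.

(** The images of the units lift to one stage, and the finitely many relations of a unit system hold
    from some later stage on. *)
Lemma limit_factor (A : semiAlgType F) (J : finType) (r : J -> J) (e : J -> J -> A)
    (c : J -> J -> A -> F) (alpha : {lrmorphism A -> T}) : matrix_basis r e c ->
  exists N, forall m, (N <= m)%N ->
    exists alpha' : {lrmorphism A -> B m}, forall a, psi m (alpha' a) = alpha a.
Proof.
move=> ec; have [e1 e2 e3] := unit_system_rmorph alpha (mb_units ec).
have [n [b bE]] := limit_lift (fun xy : J * J => alpha (e xy.1 xy.2)).
have [N1 h1] : exists N, forall m, (N <= m)%N -> forall i : J * J * J,
    let: (x, y, z) := i in r x = r y -> r y = r z ->
    tr m (b (x, y) * b (y, z)) = tr m (b (x, z)).
  apply: fin_eventually => -[[x y] z].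
  have [xy|xy] := pselect (r x = r y); last by exists 0%N.
  have [yz|yz] := pselect (r y = r z); last by exists 0%N.
  have [|N hN] := @limit_eq n (b (x, y) * b (y, z)) (b (x, z)).
    by rewrite rmorphM /= !bE e1.
  by exists N => m /hN.
have [N2 h2] : exists N, forall m, (N <= m)%N -> forall i : J * J * J * J,
    let: (x, y, z, w) := i in y != z -> tr m (b (x, y) * b (z, w)) = tr m (0 : B n).
  apply: fin_eventually => -[[[x y] z] w].
  have [yz|yz] := boolP (y != z); last by exists 0%N.
  have [|N hN] := @limit_eq n (b (x, y) * b (z, w)) 0.
    by rewrite rmorphM /= !bE e2 // rmorph0.
  by exists N => m /hN.
have [|N3 h3] := @limit_eq n (\sum_x b (x, x)) 1.
  by rewrite rmorph_sum rmorph1 -[RHS]e3; apply: eq_bigr => x _; rewrite /= bE.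
exists (maxn n (maxn N1 (maxn N2 N3))) => m; rewrite !geq_max.
move=> /and4P [nm /h1 {}h1 /h2 {}h2 /h3 {}h3].
have [t tE] := transition_lrmorphism g nm.
have bU : unit_system r (fun x y => t (b (x, y))).
  split=> [x y z xy yz|x y z w yz|].
  - by rewrite -rmorphM /= !tE; exact: (h1 (x, y, z)).
  - by rewrite -rmorphM /= tE (h2 (x, y, z, w)) // -tE rmorph0.
  by rewrite -rmorph_sum /= tE h3 -tE rmorph1.
have [a aE] := basis_extension ec bU; exists a => x.
apply: (basis_lrmorphism_eq ec (h := psi m \o a)) => y z yz /=.
by rewrite aE // tE psig // bE.
Qed.
End Stages.

(** * The intertwining argument *)

(** States f [phi(p) S] = [alpha(p) T]: on complemented idempotents of A, [alpha] induces [f]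
    composed with the map induced by [phi]. *)
Definition lifts (A S T : pzSemiRingType) (f : vmonoid S -> vmonoid T)
    (phi : A -> S) (alpha : A -> T) : Prop :=
  forall p, complemented p -> forall v, vrep v (phi p) -> vrep (f v) (alpha p).

Lemma unit_idem (A : pzSemiRingType) (J : finType) (r : J -> J) (e : J -> J -> A) x :
  unit_system r e -> e x x * e x x = e x x.
Proof. by case=> e1 _ _; rewrite e1. Qed.

Lemma unit_complemented (A : pzSemiRingType) (J : finType) (r : J -> J)
    (e : J -> J -> A) x : unit_system r e -> complemented (e x x).
Proof.
move=> eU; split; first exact: unit_idem eU.
by exists (\sum_(y | y != x) e y y); case: eU => _ _ <-; rewrite [RHS](bigD1 x).
Qed.

(** * Realizing f by a morphism on one matricial algebra *)

Section Existence.
Variables (F : comNzSemiRingType) (A S T : semiAlgType F).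
Variables (J : finType) (r : J -> J) (e : J -> J -> A) (c : J -> J -> A -> F).
Hypothesis ec : matrix_basis r e c.
Variables (f : vmonoid S -> vmonoid T).
Hypotheses (f0 : f (vzero S) = vzero T) (fD : {morph f : x y / vadd x y}).
Hypothesis f1 : f (vclass (fgproj_regular S)) = vclass (fgproj_regular T).

(** The decomposition of [S] into the classes of the diagonal units is carried by [f] to a
    decomposition of [T], which is realized by idempotents of T and completed to matrix units. *)
Lemma lifts_exists (phi : {lrmorphism A -> S}) :
  exists alpha : {lrmorphism A -> T}, lifts f phi alpha.
Proof.
have phiU := unit_system_rmorph phi (mb_units ec).
have rr := mb_repr ec.
have [v vE] := choice (fun x => vrep_ex (unit_idem x phiU)).
have fsum (s : seq J) : f (\big[@vadd S/vzero S]_(x <- s) v x) =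
    \big[@vadd T/vzero T]_(x <- s) f (v x) by apply: big_morph.
have vsum (s : seq J) : uniq s ->
    vrep (\big[@vadd S/vzero S]_(x <- s) v x) (\sum_(x <- s) phi (e x x)).
  move=> us; apply: vrep_sum => // x y _ _ xy.
  by case: phiU => _ h _; apply: h.
have v1 : vclass (fgproj_regular S) = \big[@vadd S/vzero S]_(x <- index_enum J) v x.
  apply/(vrep_mvn (vrep_reg S) (vsum _ (index_enum_uniq J))).
  by case: phiU => _ _ ->; apply: mvn_refl; rewrite mulr1.
(* The unit of T represents f [S], so it splits into orthogonal idempotents [t x] of classes
   [f (v x)]. *)
have := vrep_reg T; rewrite -f1 v1 fsum => /(vrep_sum_split (index_enum_uniq J)).
move=> [t [vt tO t1]].
have {}vt x : vrep (f (v x)) (t x) by apply: vt; rewrite mem_index_enum.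
have {}tO x y : x != y -> t x * t y = 0 by apply: tO; rewrite mem_index_enum.
have tI x : t x * t x = t x := vrep_idem (vt x).
have trx x : mvn_equiv (t x) (t (r x)).
  apply/(vrep_mvn (vt x) (vt (r x))); congr f; apply/(vrep_mvn (vE x) (vE (r x))).
  by exists (phi (e x (r x))), (phi (e (r x) x)); case: phiU => h _ _; rewrite !h ?rr.
have [u uE] := choice (fun x => mvn_normalize (tI x) (tI (r x)) (trx x)).
have [w wE] := choice uE.
(* Within a block, [u x * w y] links [t x] to [t y] through the common representative. *)
have eU : unit_system r (fun x y => u x * w y).
  split=> [x y z xy yz|x y z a yz|].
  - have [_ _ _ ut _] := wE x; have [_ wu _ _ _] := wE y.
    by rewrite -!mulrA (mulrA (w y)) wu (mulrA (u x)) -xy ut.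
  - have [_ _ tu _ _] := wE z; have [_ _ _ _ [_ wt]] := wE y.
    by rewrite -wt -tu -!mulrA (mulrA (t y)) tO // mul0r !mulr0.
  by rewrite -t1; apply: eq_bigr => x _; have [] := wE x.
have [alpha alphaE] := basis_extension ec eU.
have aE x : alpha (e x x) = t x by rewrite alphaE //; have [] := wE x.
(* A complemented [p] is equivalent to a sum of diagonal units, for which the claim follows from
   additivity of [f]. *)
exists alpha => p pC x xp; have [D pD] := mb_complemented ec pC.
have phiD : x = \big[@vadd S/vzero S]_(y <- enum D) v y.
  apply/(vrep_mvn xp (vsum _ (enum_uniq D))).
  by rewrite big_enum -rmorph_sum; apply: mvn_rmorph.
apply: (@vrep_equiv _ _ (\sum_(y <- enum D) t y)).
- by have [pp _] := pC; rewrite -rmorphM pp.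
- rewrite big_enum (eq_bigr (fun y => alpha (e y y))) => [|y _]; last by rewrite aE.
  by rewrite -rmorph_sum; apply/mvn_rmorph/mvn_sym.
rewrite phiD fsum; apply: vrep_sum => [|y _|y z _ _]; [exact: enum_uniq|exact: vt|].
exact: tO.
Qed.
End Existence.

Definition chain_limit (F : comNzSemiRingType) (A : nat -> semiAlgType F)
    (a : forall n, {lrmorphism A n -> A n.+1}) (S : semiAlgType F)
    (phi : forall n, {lrmorphism A n -> S}) : Prop :=
  is_direct_limit a phi /\ forall n, matricial (A n).

(** * One rung of the ladder *)

Section Step.
Variables (F : comNzSemiRingType) (hF : is_semifield F).
Variables (A B : nat -> semiAlgType F).
Variables (a : forall n, {lrmorphism A n -> A n.+1}).
Variables (b : forall n, {lrmorphism B n -> B n.+1}).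
Variables (S T : semiAlgType F).
Variables (phi : forall n, {lrmorphism A n -> S}).
Variables (psi : forall n, {lrmorphism B n -> T}).
Hypotheses (limS : chain_limit a phi) (limT : chain_limit b psi).
Variables (f : vmonoid S -> vmonoid T) (g : vmonoid T -> vmonoid S).
Hypotheses (f0 : f (vzero S) = vzero T) (fD : {morph f : x y / vadd x y}).
Hypothesis f1 : f (vclass (fgproj_regular S)) = vclass (fgproj_regular T).
Hypothesis gK : cancel g f.

Lemma lifts_stage n : exists N, forall m, (N <= m)%N ->
  exists alpha : {lrmorphism A n -> B m}, lifts f (phi n) (psi m \o alpha).
Proof.
have [J [r [e [c ec]]]] := matricial_basis hF (limS.2 n).
have [alpha alphaP] := lifts_exists ec f0 fD f1 (phi n).
have [N NE] := limit_factor limT.1 alpha ec; exists N => m /NE [k kE].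
by exists k => p pC v /(alphaP _ pC); rewrite /= kE.
Qed.

(** A first lift makes the triangle commute on classes only. At a late stage the two sides are
    conjugate, and conjugating the lift makes the triangle commute exactly. *)
Lemma lifts_step n m (beta : {lrmorphism B m -> A n}) :
  lifts g (psi m) (phi n \o beta) ->
  exists N, forall m', (N <= m')%N -> exists alpha : {lrmorphism A n -> B m'},
    lifts f (phi n) (psi m' \o alpha) /\
    forall x, alpha (beta x) = transition b m' x.
Proof.
move=> betaP; have [N NE] := lifts_stage n.
pose m1 := maxn N m; have [al alP] := NE m1 (leq_maxl _ _).
have mm1 : (m <= m1)%N by rewrite leq_maxr.
have [J [r [e [c ec]]]] := matricial_basis hF (limT.2 m).
have ee x := unit_complemented x (mb_units ec).
have psib := transition_cocone limT.1.1.
(* If [v] is the class of the left idempotent, the right one has class f (g v) = v. *)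
have eqv x : mvn_equiv (psi m1 (transition b m1 (e x x))) (psi m1 (al (beta (e x x)))).
  have [v vx] := vrep_ex (complemented_rmorph (psi m) (ee x)).1.
  have := alP _ (complemented_rmorph beta (ee x)) _ (betaP _ (ee x) _ vx).
  by rewrite gK psib // => /(vrep_mvn vx) [h _]; apply: h.
have [M ME] := fin_eventually (fun x => limit_mvn limT.1 (eqv x)).
exists (maxn m1 M) => m'; rewrite geq_max => /andP [m1m' /ME {}ME].
have [t1 t1E] := transition_lrmorphism b mm1.
have [t2 t2E] := transition_lrmorphism b m1m'.
have [|w [w' [ww' w'w wE]]] := basis_conj ec (h := t2 \o (al \o beta)) (h' := t2 \o t1).
  by move=> x /=; rewrite t1E !t2E; apply: mvn_sym; apply: ME.
have [k kE] := conj_lrmorphism (t2 \o al) w'w ww'.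
exists k; split=> [p pC v /(alP _ pC) /= vp|x]; last first.
  by have /= := wE x; rewrite kE /= => <-; rewrite t2E t1E transition_comp.
apply: vrep_equiv vp; first by rewrite -rmorphM -rmorphM pC.1.
have e0 : psi m' (t2 (al p)) = psi m1 (al p) by rewrite t2E psib.
rewrite -e0 kE /=.
(* With q the image of [p], the pair q w', w q shows that q is equivalent to w q w', so conjugation
   preserves classes. *)
exists (psi m' (t2 (al p) * w')), (psi m' (w * t2 (al p))); rewrite -!rmorphM.
have q2 : t2 (al p) * t2 (al p) = t2 (al p) by rewrite -!rmorphM pC.1.
split; first by rewrite !mulrA -(mulrA _ w') w'w mulr1 q2.
by rewrite -!mulrA (mulrA (t2 _) (t2 _)) q2.
Qed.
End Step.

(** * The ladder and the isomorphism of the limits *)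

Section Intertwining.
Variables (F : comNzSemiRingType) (hF : is_semifield F).
Variables (A B : nat -> semiAlgType F).
Variables (a : forall n, {lrmorphism A n -> A n.+1}).
Variables (b : forall n, {lrmorphism B n -> B n.+1}).
Variables (S T : semiAlgType F).
Variables (phi : forall n, {lrmorphism A n -> S}).
Variables (psi : forall n, {lrmorphism B n -> T}).
Hypotheses (limS : chain_limit a phi) (limT : chain_limit b psi).
Variables (f : vmonoid S -> vmonoid T) (g : vmonoid T -> vmonoid S).
Hypotheses (f0 : f (vzero S) = vzero T) (fD : {morph f : x y / vadd x y}).
Hypothesis f1 : f (vclass (fgproj_regular S)) = vclass (fgproj_regular T).
Hypotheses (fK : cancel f g) (gK : cancel g f).

Record stage := Stage {
  st_src : nat;
  st_tgt : nat;
  st_map : {lrmorphism A st_src -> B st_tgt};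
  st_lifts : lifts f (phi st_src) (psi st_tgt \o st_map) }.

(** Both triangles around [beta] commute exactly, and the strict growth of the indices makes the
    rungs cofinal in both chains. *)
Definition stage_next (s s' : stage) : Prop :=
  [/\ (st_src s < st_src s')%N, (st_tgt s < st_tgt s')%N &
    exists beta : {lrmorphism B (st_tgt s) -> A (st_src s')},
      (forall x, beta (st_map s x) = transition a (st_src s') x) /\
      (forall y, st_map s' (beta y) = transition b (st_tgt s') y)].

Lemma stage_next_exists s : exists s', stage_next s s'.
Proof.
have g0 : g (vzero T) = vzero S by rewrite -f0 fK.
have gD : {morph g : x y / vadd x y}.
  by move=> x y; apply: (can_inj fK); rewrite fD !gK.
have g1 : g (vclass (fgproj_regular T)) = vclass (fgproj_regular S).
  by rewrite -f1 fK.
case: s => n m al alP.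
have [N NE] := lifts_step hF limT limS g0 gD g1 fK alP.
have [beta [betaP betaE]] := NE (maxn N n.+1) (leq_maxl _ _).
have [M ME] := lifts_step hF limS limT f0 fD f1 gK betaP.
(* [lifts_step] is applied first with S and T exchanged, then directly; the maxima enforce strict
   growth. *)
have [al' [al'P al'E]] := ME (maxn M m.+1) (leq_maxl _ _).
exists (Stage al'P); split=> /=; [exact: leq_maxr|exact: leq_maxr|].
by exists beta.
Qed.

Lemma stage_sequence : exists st : nat -> stage, forall k, stage_next (st k) (st k.+1).
Proof.
have [N /(_ N (leqnn N)) [al alP]] := lifts_stage hF limS limT f0 fD f1 0.
have [next nextP] := choice stage_next_exists.
by exists (fun k => iter k next (Stage alP)) => k; apply: nextP.
Qed.

(** The rungs form a cocone from the first chain to T, inducing H on S; the maps [beta] back provide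
    injectivity and surjectivity. *)
Lemma alg_iso_of_vmonoid_iso : alg_iso S T.
Proof.
have [[phia univ] _] := limS; have [[psib _] _] := limT.
have phitr := transition_cocone phia; have psitr := transition_cocone psib.
have [st stP] := stage_sequence.
pose n k := st_src (st k); pose m k := st_tgt (st k).
pose al k : {lrmorphism A (n k) -> B (m k)} := st_map (st k).
have n_mono k l : (k <= l)%N -> (n k <= n l)%N.
  by apply: (homo_leq leqnn leq_trans) => i; apply: ltnW; case: (stP i).
have m_mono k l : (k <= l)%N -> (m k <= m l)%N.
  by apply: (homo_leq leqnn leq_trans) => i; apply: ltnW; case: (stP i).
(* Needed for the transition from [A k] to [A (n k)] to be a morphism rather than a default
   value. *)
have n_ge k : (k <= n k)%N.
  by elim: k => // k IH; apply: leq_ltn_trans IH _; case: (stP k).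
have m_ge k : (k <= m k)%N.
  by elim: k => // k IH; apply: leq_ltn_trans IH _; case: (stP k).
(* Two consecutive triangles compose to a commuting square between neighbouring rungs. *)
have al_tr k l x : (k <= l)%N ->
    al l (transition a (n l) x) = transition b (m l) (al k x).
  move: l; apply: transition_ind; first by rewrite !transition_id.
  move=> l kl IH; have [_ _ [beta [betaE alE]]] := stP l.
  rewrite -(transition_comp _ x (n_mono _ _ kl) (n_mono _ _ (leqnSn l))).
  rewrite -betaE [LHS]alE IH (transition_comp _ _ (m_mono _ _ kl)) //.
  exact: m_mono (leqnSn l).
have [h hE] : exists h : forall k, {lrmorphism A k -> T},
    forall k x, h k x = psi (m k) (al k (transition a (n k) x)).
  apply: (@dep_choice _ _ (fun k (hk : {lrmorphism A k -> T}) =>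
    forall x, hk x = psi (m k) (al k (transition a (n k) x)))) => k.
  have [t tE] := transition_lrmorphism a (n_ge k).
  by exists (psi (m k) \o (al k \o t)) => x /=; rewrite tE.
have ha k x : h k.+1 (a k x) = h k x.
  rewrite !hE -[x in a k x](transition_id a) -transition_step //.
  rewrite (transition_comp _ _ (leqnSn k) (n_ge _)).
  rewrite -(transition_comp _ x (n_ge k) (n_mono _ _ (leqnSn k))).
  by rewrite al_tr // psitr // m_mono.
have [H [HE _]] := univ T h ha; exists H.
have Hinj : injective H.
  move=> x y.
  have [i [u <-]] := direct_limit_surj limS.1 x.
  have [j [v <-]] := direct_limit_surj limS.1 y.
  pose k := maxn i j.
  rewrite -(phitr _ k u) ?leq_maxl // -(phitr _ k v) ?leq_maxr // !HE !hE.
  move: (transition a k u) (transition a k v) => {}u {}v.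
  (* Equality in T already holds in [B M]; the rung at [l] lies beyond it, and [beta] carries the
     equality back to the first chain. *)
  move=> /(direct_limit_inj limT.1) [M [mM uv]].
  pose l := maxn k M.
  have kl : (k <= l)%N by rewrite leq_maxl.
  have Ml : (M <= m l)%N by apply: leq_trans (m_ge l); rewrite leq_maxr.
  have al_uv : al l (transition a (n l) (transition a (n k) u)) =
      al l (transition a (n l) (transition a (n k) v)).
    by rewrite !al_tr // -!(transition_comp _ _ mM Ml) uv.
  have [_ _ [beta [betaE _]]] := stP l.
  have := congr1 (fun z => phi (n l.+1) (beta z)) al_uv.
  rewrite !betaE !(phitr (n l) (n l.+1)) ?n_mono //.
  by rewrite !(phitr (n k)) ?n_mono // !phitr.
have Hsurj y : exists x, H x = y.
  have [k [v <-]] := direct_limit_surj limT.1 y.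
  have [_ _ [beta [_ alE]]] := stP k.
  (* The preimage is found by moving to the rung and going back along [beta]; the next rung then
     returns the original element. *)
  exists (phi (n k.+1) (beta (transition b (m k) v))).
  have kn : (n k.+1 <= n (n k.+1))%N by rewrite n_mono // n_ge.
  rewrite HE hE al_tr ?n_ge // psitr ?m_mono ?n_ge //.
  by rewrite [al _ _]alE !psitr // m_mono.
have [K HK] := choice Hsurj.
by exists K => // x; apply: Hinj; rewrite HK.
Qed.
End Intertwining.

Theorem theorem5p11 (F : comNzSemiRingType) (hF : is_semifield F)
    (S T : semiAlgType F) (hS : ultramatricial S) (hT : ultramatricial T) :
  (exists f : vmonoid S -> vmonoid T,
     vmonoid_iso f /\ f (vclass (fgproj_regular S)) = vclass (fgproj_regular T))
  <-> alg_iso S T.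
Proof.
split=> [[f [[f0 fD [g fK gK]] f1]]|[h hb]]; last first.
  exact: vmonoid_iso_of_rmorphism hb.
have [A [a [phi [matA limS]]]] := hS; have [B [b [psi [matB limT]]]] := hT.
exact: (alg_iso_of_vmonoid_iso hF (conj limS matA) (conj limT matB) f0 fD f1 fK gK).
Qed.
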